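(* Let $\mathbb{M}=\langle M,\mathcal{C}\rangle$ be a countable transitive model of $\mathsf{GB}^-$ such that $\mathcal{C}$ contains a well-order of $M$ of order type $\mathrm{Ord}^M$. Then a separative antisymmetric notion of class forcing $\mathbb{P}$ for $\mathbb{M}$ has a unique Boolean completion in $\mathbb{M}$ if and only if it satisfies the $\mathrm{Ord}$-cc over $\mathbb{M}$.
   Context: We work in a model $\mathsf{V}$ of $\mathsf{ZFC}$. $\mathsf{ZF}^-$ is $\mathsf{ZF}$ without power set and with Collection instead of Replacement. $\mathsf{GB}^-$ is the two-sorted theory (sets and classes) whose set axioms are those of $\mathsf{ZF}^-$ with class parameters allowed in Separation and Collection and whose class axioms are extensionality, foundation and first-order class comprehension (only set quantifiers). A countable transitive model of $\mathsf{GB}^-$ is a model $\mathbb{M}=\langle M,\mathcal{C}\rangle$ of $\mathsf{GB}^-$ (sets: $M$; classes: $\mathcal{C}\subseteq\mathcal{P}(M)$) with $M$ transitive and $M,\mathcal{C}$ countable in $\mathsf{V}$. A notion of class forcing for $\mathbb{M}$ is a preorder $\mathbb{P}=\langle P,\leq_{\mathbb{P}}\rangle$ with $P,\leq_{\mathbb{P}}\in\mathcal{C}$. It is separative if for all $p\not\leq q$ there is $r\leq p$ incompatible with $q$. A Boolean algebra $\mathbb{B}$ is $M$-complete if $\sup_{\mathbb{B}}A$ exists for every $A\in M$ with $A\subseteq\mathbb{B}$. A Boolean completion of $\mathbb{P}$ in $\mathbb{M}$ is an $M$-complete Boolean algebra $\mathbb{B}$ such that its domain, all its Boolean operations and an injective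 dense embedding $\pi$ of $\mathbb{P}$ into $\mathbb{B}\setminus\{0_{\mathbb{B}}\}$ (an injective map with $p\leq q\Leftrightarrow\pi(p)\leq\pi(q)$ and dense range) are elements of $\mathcal{C}$. $\mathbb{P}$ has a unique Boolean completion in $\mathbb{M}$ if it has a Boolean completion $\mathbb{B}_0$ in $\mathbb{M}$ and for every other Boolean completion $\mathbb{B}_1$ of $\mathbb{P}$ in $\mathbb{M}$ there is an isomorphism in $\mathsf{V}$ between $\mathbb{B}_0$ and $\mathbb{B}_1$ which fixes $\mathbb{P}$ (i.e. commutes with the embeddings of $\mathbb{P}$). $\mathbb{P}$ satisfies the $\mathrm{Ord}$-chain condition ($\mathrm{Ord}$-cc) over $\mathbb{M}$ if every antichain of $\mathbb{P}$ which is in $\mathcal{C}$ is already in $M$. *)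

(* Defs.v *)
(** Sets live in an arbitrary structure [V] with one binary relation, later
    assumed to satisfy ZFC.  All set-theoretic notions are read inside [V]; no
    library beyond the prelude is used. *)

Set Implicit Arguments.
Unset Strict Implicit.
Unset Printing Implicit Defensive.

Record set_structure := SetStructure {
  carrier :> Type;
  mem : carrier -> carrier -> Prop
}.
Arguments mem {s} _ _.

Notation "x ∈ y" := (mem x y) (at level 70, no associativity).
Notation "x ∉ y" := (~ mem x y) (at level 70, no associativity).

(** * First-order formulas without class quantifiers

    Set variables are de Bruijn indices; class variables are indices into a
    separate environment and are never bound. *)

Inductive form :=
| FIn (i j : nat)
| FEq (i j : nat)
| FInC (i k : nat)
| FBot
| FImp (f g : form)
| FAll (f : form).

Definition scons (A : Type) (x : A) (s : nat -> A) (n : nat) : A :=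
  match n with O => x | S m => s m end.

(** [D] is the range of the set quantifiers, [s] and [c] are the assignments of
    the set and class variables. *)
Fixpoint sat (V : set_structure) (D : V -> Prop) (s c : nat -> V) (f : form)
  : Prop :=
  match f with
  | FIn i j => s i ∈ s j
  | FEq i j => s i = s j
  | FInC i k => s i ∈ c k
  | FBot => False
  | FImp g h => sat D s c g -> sat D s c h
  | FAll g => forall x, D x -> sat D (scons x s) c g
  end.

(** * Theories, for the two-sorted structure whose sets are the elements of [D]
    and whose classes are the elements of [K] *)

Section Theories.
Context {V : set_structure}.
Implicit Types (D K : V -> Prop) (x y z a b : V).

Definition ax_extensionality D :=
  forall a b, D a -> D b -> (forall x, D x -> (x ∈ a <-> x ∈ b)) -> a = b.

Definition ax_foundation D :=
  forall a, D a -> (exists x, D x /\ x ∈ a) ->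
  exists x, D x /\ x ∈ a /\ forall y, D y -> y ∈ x -> y ∉ a.

Definition ax_pairing D :=
  forall a b, D a -> D b ->
  exists z, D z /\ forall x, D x -> (x ∈ z <-> x = a \/ x = b).

Definition ax_union D :=
  forall a, D a ->
  exists z, D z /\ forall x, D x -> (x ∈ z <-> exists y, D y /\ y ∈ a /\ x ∈ y).

Definition ax_infinity D :=
  exists a, D a /\
    (exists x, D x /\ x ∈ a /\ forall y, D y -> y ∉ x) /\
    (forall x, D x -> x ∈ a -> exists y, D y /\ y ∈ a /\
       forall z, D z -> (z ∈ y <-> z ∈ x \/ z = x)).

Definition ax_power D :=
  forall a, D a ->
  exists b, D b /\ forall x, D x -> (x ∈ b <-> forall y, D y -> y ∈ x -> y ∈ a).

Definition ax_choice D :=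
  forall a, D a ->
  (forall x, D x -> x ∈ a -> exists y, D y /\ y ∈ x) ->
  (forall x y z, D x -> D y -> D z -> x ∈ a -> y ∈ a -> z ∈ x -> z ∈ y -> x = y) ->
  exists b, D b /\ forall x, D x -> x ∈ a ->
    exists! y, D y /\ y ∈ x /\ y ∈ b.

Definition ax_separation D K :=
  forall (f : form) (s c : nat -> V), (forall n, D (s n)) -> (forall n, K (c n)) ->
  forall a, D a ->
  exists b, D b /\ forall x, D x -> (x ∈ b <-> x ∈ a /\ sat D (scons x s) c f).

Definition ax_collection D K :=
  forall (f : form) (s c : nat -> V), (forall n, D (s n)) -> (forall n, K (c n)) ->
  forall a, D a ->
  (forall x, D x -> x ∈ a ->
     exists y, D y /\ sat D (scons x (scons y s)) c f) ->
  exists b, D b /\ forall x, D x -> x ∈ a ->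
     exists y, D y /\ y ∈ b /\ sat D (scons x (scons y s)) c f.

Definition ax_replacement D K :=
  forall (f : form) (s c : nat -> V), (forall n, D (s n)) -> (forall n, K (c n)) ->
  forall a, D a ->
  (forall x y y', D x -> D y -> D y' -> x ∈ a ->
     sat D (scons x (scons y s)) c f -> sat D (scons x (scons y' s)) c f ->
     y = y') ->
  exists b, D b /\ forall y, D y ->
     (y ∈ b <-> exists x, D x /\ x ∈ a /\ sat D (scons x (scons y s)) c f).

Definition ax_class_extensionality D K :=
  forall X Y, K X -> K Y -> (forall x, D x -> (x ∈ X <-> x ∈ Y)) -> X = Y.

Definition ax_class_foundation D K :=
  forall X, K X -> (exists x, D x /\ x ∈ X) ->
  exists x, D x /\ x ∈ X /\ forall y, D y -> y ∈ x -> y ∉ X.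

Definition ax_class_comprehension D K :=
  forall (f : form) (s c : nat -> V), (forall n, D (s n)) -> (forall n, K (c n)) ->
  exists X, K X /\ forall x, D x -> (x ∈ X <-> sat D (scons x s) c f).

End Theories.

(** With both sorts equal to the whole of [V], a class variable is just one more
    set parameter, so the two schemas below are those of one-sorted ZFC. *)
Record ZFC (V : set_structure) : Prop := {
  zfc_extensionality : ax_extensionality (fun _ : V => True);
  zfc_foundation : ax_foundation (fun _ : V => True);
  zfc_pairing : ax_pairing (fun _ : V => True);
  zfc_union : ax_union (fun _ : V => True);
  zfc_infinity : ax_infinity (fun _ : V => True);
  zfc_power : ax_power (fun _ : V => True);
  zfc_choice : ax_choice (fun _ : V => True);
  zfc_separation : ax_separation (fun _ : V => True) (fun _ => True);
  zfc_replacement : ax_replacement (fun _ : V => True) (fun _ => True)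
}.

Record GBminus (V : set_structure) (D K : V -> Prop) : Prop := {
  gb_extensionality : ax_extensionality D;
  gb_foundation : ax_foundation D;
  gb_pairing : ax_pairing D;
  gb_union : ax_union D;
  gb_infinity : ax_infinity D;
  gb_separation : ax_separation D K;
  gb_collection : ax_collection D K;
  gb_class_extensionality : ax_class_extensionality D K;
  gb_class_foundation : ax_class_foundation D K;
  gb_class_comprehension : ax_class_comprehension D K
}.

Section Notions.
Context {V : set_structure}.
Implicit Types (M C P A B X Y R W G x y z p q r t : V).

(** * Basic set theory in [V] *)

Definition incl X Y := forall x, x ∈ X -> x ∈ Y.

Definition is_upair t x y := forall z, z ∈ t <-> z = x \/ z = y.

(** Kuratowski: [t = {{x}, {x, y}}]. *)
Definition is_opair t x y :=
  exists a b, is_upair a x x /\ is_upair b x y /\ is_upair t a b.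

Definition rel R x y := exists t, is_opair t x y /\ t ∈ R.

Definition relation_on X R :=
  forall t, t ∈ R -> exists x y, x ∈ X /\ y ∈ X /\ is_opair t x y.

(** The set [G] is the graph of (the restriction to [X], resp. [X × X], of) the
    function [f].  Values of [f] elsewhere are irrelevant. *)
Definition graph1 X (f : V -> V) G :=
  forall t, t ∈ G <-> exists x, x ∈ X /\ is_opair t x (f x).

Definition graph2 X (f : V -> V -> V) G :=
  forall t, t ∈ G <->
    exists x y u, x ∈ X /\ y ∈ X /\ is_opair u x y /\ is_opair t u (f x y).

Definition maps_to X (f : V -> V) Y := forall x, x ∈ X -> f x ∈ Y.

Definition injective_on X (f : V -> V) :=
  forall x y, x ∈ X -> y ∈ X -> f x = f y -> x = y.

Definition bijective_between X (f : V -> V) Y :=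
  maps_to X f Y /\ injective_on X f /\
  forall y, y ∈ Y -> exists x, x ∈ X /\ f x = y.

Definition inductive X :=
  (exists x, x ∈ X /\ forall y, y ∉ x) /\
  (forall x, x ∈ X -> exists y, y ∈ X /\ forall z, z ∈ y <-> z ∈ x \/ z = x).

Definition is_omega X := inductive X /\ forall Y, inductive Y -> incl X Y.

Definition countable X :=
  exists (w : V) (f : V -> V) (G : V),
    is_omega w /\ graph1 X f G /\ maps_to X f w /\ injective_on X f.

Definition transitive X := forall x, x ∈ X -> incl x X.

(** Strict well-orders. *)
Record well_orders (X : V) (lt : V -> V -> Prop) : Prop := {
  wo_irrefl : forall x, x ∈ X -> ~ lt x x;
  wo_trans : forall x y z, x ∈ X -> y ∈ X -> z ∈ X -> lt x y -> lt y z -> lt x z;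
  wo_total : forall x y, x ∈ X -> y ∈ X -> lt x y \/ x = y \/ lt y x;
  wo_least : forall S : V, incl S X -> (exists x, x ∈ S) ->
    exists x, x ∈ S /\ forall y, y ∈ S -> ~ lt y x
}.

Definition ordinal x := transitive x /\ well_orders x (fun y z => y ∈ z).

(** * Countable transitive models *)

Record ctm_GBminus M C : Prop := {
  ctm_transitive : transitive M;
  ctm_classes : forall X, X ∈ C -> incl X M;
  ctm_model : GBminus (fun x => x ∈ M) (fun X => X ∈ C);
  ctm_countable_sets : countable M;
  ctm_countable_classes : countable C
}.

Definition is_Ord_of M X := forall x, x ∈ X <-> x ∈ M /\ ordinal x.

Definition has_order_type_Ord M W :=
  exists (O : V) (f : V -> V) (G : V),
    is_Ord_of M O /\ graph1 M f G /\ bijective_between M f O /\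
    forall x y, x ∈ M -> y ∈ M -> (rel W x y <-> f x ∈ f y).

Definition has_wellorder_of_type_Ord M C :=
  exists W, W ∈ C /\ relation_on M W /\ well_orders M (rel W) /\
    has_order_type_Ord M W.

(** * Class forcing *)

Record class_forcing C P R : Prop := {
  cf_domain : P ∈ C;
  cf_order : R ∈ C;
  cf_relation : relation_on P R;
  cf_refl : forall p, p ∈ P -> rel R p p;
  cf_trans : forall p q r, p ∈ P -> q ∈ P -> r ∈ P ->
    rel R p q -> rel R q r -> rel R p r
}.

Definition antisymmetric P R :=
  forall p q, p ∈ P -> q ∈ P -> rel R p q -> rel R q p -> p = q.

Definition incompatible P R p q :=
  ~ exists r, r ∈ P /\ rel R r p /\ rel R r q.

Definition separative P R :=
  forall p q, p ∈ P -> q ∈ P -> ~ rel R p q ->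
  exists r, r ∈ P /\ rel R r p /\ incompatible P R r q.

Definition antichain P R A :=
  incl A P /\
  forall p q, p ∈ A -> q ∈ A -> p <> q -> incompatible P R p q.

Definition Ord_cc M C P R := forall A, A ∈ C -> antichain P R A -> A ∈ M.

(** * Boolean completions *)

Record ba_data := BaData {
  dom : V;
  meet : V -> V -> V;
  join : V -> V -> V;
  compl : V -> V;
  zero : V;
  one : V
}.

(** Complemented distributive lattices; the one-element algebra is allowed. *)
Record boolean_algebra (B : ba_data) : Prop := {
  ba_meet_dom : forall x y, x ∈ dom B -> y ∈ dom B -> meet B x y ∈ dom B;
  ba_join_dom : forall x y, x ∈ dom B -> y ∈ dom B -> join B x y ∈ dom B;
  ba_compl_dom : forall x, x ∈ dom B -> compl B x ∈ dom B;
  ba_zero_dom : zero B ∈ dom B;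
  ba_one_dom : one B ∈ dom B;
  ba_meetC : forall x y, x ∈ dom B -> y ∈ dom B -> meet B x y = meet B y x;
  ba_joinC : forall x y, x ∈ dom B -> y ∈ dom B -> join B x y = join B y x;
  ba_meetA : forall x y z, x ∈ dom B -> y ∈ dom B -> z ∈ dom B ->
    meet B x (meet B y z) = meet B (meet B x y) z;
  ba_joinA : forall x y z, x ∈ dom B -> y ∈ dom B -> z ∈ dom B ->
    join B x (join B y z) = join B (join B x y) z;
  ba_meetK : forall x y, x ∈ dom B -> y ∈ dom B -> meet B x (join B x y) = x;
  ba_joinK : forall x y, x ∈ dom B -> y ∈ dom B -> join B x (meet B x y) = x;
  ba_meet_join : forall x y z, x ∈ dom B -> y ∈ dom B -> z ∈ dom B ->
    meet B x (join B y z) = join B (meet B x y) (meet B x z);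
  ba_meet_compl : forall x, x ∈ dom B -> meet B x (compl B x) = zero B;
  ba_join_compl : forall x, x ∈ dom B -> join B x (compl B x) = one B
}.

Definition ba_le (B : ba_data) x y := meet B x y = x.

Definition is_sup (B : ba_data) A x :=
  x ∈ dom B /\ (forall a, a ∈ A -> ba_le B a x) /\
  forall y, y ∈ dom B -> (forall a, a ∈ A -> ba_le B a y) -> ba_le B x y.

Definition complete_for M (B : ba_data) :=
  forall A, A ∈ M -> incl A (dom B) -> exists x, is_sup B A x.

(** [B] belongs to the class part [C]; the constants of [B] are elements of
    [dom B], hence sets of the model. *)
Definition ba_in_classes C (B : ba_data) :=
  dom B ∈ C /\
  (exists G, G ∈ C /\ graph2 (dom B) (meet B) G) /\
  (exists G, G ∈ C /\ graph2 (dom B) (join B) G) /\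
  (exists G, G ∈ C /\ graph1 (dom B) (compl B) G).

Record dense_embedding P R (B : ba_data) (e : V -> V) : Prop := {
  de_maps : maps_to P e (dom B);
  de_nonzero : forall p, p ∈ P -> e p <> zero B;
  de_injective : injective_on P e;
  de_order : forall p q, p ∈ P -> q ∈ P -> (rel R p q <-> ba_le B (e p) (e q));
  de_dense : forall b, b ∈ dom B -> b <> zero B ->
    exists p, p ∈ P /\ ba_le B (e p) b
}.

Record boolean_completion M C P R (B : ba_data) (e : V -> V) : Prop := {
  bc_algebra : boolean_algebra B;
  bc_complete : complete_for M B;
  bc_classes : ba_in_classes C B;
  bc_embedding : dense_embedding P R B e;
  bc_embedding_class : exists G, G ∈ C /\ graph1 P e G
}.

Record ba_isomorphism (B0 B1 : ba_data) (h : V -> V) : Prop := {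
  iso_bij : bijective_between (dom B0) h (dom B1);
  iso_meet : forall x y, x ∈ dom B0 -> y ∈ dom B0 ->
    h (meet B0 x y) = meet B1 (h x) (h y);
  iso_join : forall x y, x ∈ dom B0 -> y ∈ dom B0 ->
    h (join B0 x y) = join B1 (h x) (h y);
  iso_compl : forall x, x ∈ dom B0 -> h (compl B0 x) = compl B1 (h x);
  iso_zero : h (zero B0) = zero B1;
  iso_one : h (one B0) = one B1
}.

(** The isomorphism has to be an element of [V], i.e. its graph is a set. *)
Definition isomorphic_over P (B0 : ba_data) (e0 : V -> V)
    (B1 : ba_data) (e1 : V -> V) :=
  exists (h : V -> V) (G : V),
    graph1 (dom B0) h G /\ ba_isomorphism B0 B1 h /\
    forall p, p ∈ P -> h (e0 p) = e1 p.

Definition has_unique_completion M C P R :=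
  exists (B0 : ba_data) (e0 : V -> V),
    boolean_completion M C P R B0 e0 /\
    forall (B1 : ba_data) (e1 : V -> V),
      boolean_completion M C P R B1 e1 -> isomorphic_over P B0 e0 B1 e1.

End Notions.

(* Main.v *)
(** A Boolean completion is determined by which classes of conditions are cones
    [{p | e p <= b}], and these are regular open.  Under the [Ord]-cc every regular
    open class in [C] is generated by a maximal antichain inside it, hence by a set;
    so the completion must consist of all of them, and sets of conditions serve as
    codes.  Conversely, given an antichain [A] in [C] that is not a set, diagonalizing
    the elements of a completion along [A] gives a subclass of [A] without a supremum.
    Adjoining that supremum yields another completion in [C], not isomorphic to the
    first one over [P]. *)

(* Class comprehension has no class quantifiers and power set is absent, so neither a collection of
   all regular open classes nor a quotient by equivalence classes of codes is at hand. Elements of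
   an algebra are therefore [W]-least codes, and every class must come from a formula with set
   quantifiers only. Arguments are phrased with predicates on [V]; tactics supply the formulas.

   Maximal antichains and enumerations come from a single recursion along the ordinals of the model,
   which picks the [W]-least element suitably related to all earlier values. Initial segments of [W]
   are not assumed to be sets, so the fact that the enumeration of [M] reaches every set is proved
   in [V], from the isomorphism between [W] and the ordinals.

   In a Boolean algebra with a dense embedding, order is inclusion of cones, and each operation acts
   on cones by a density condition. Algebraic laws, completeness and isomorphism all reduce to
   statements about density below conditions. *)
From Stdlib Require Import Classical ClassicalEpsilon ssreflect.
Require Import Defs.

Set Implicit Arguments.
Unset Strict Implicit.
Unset Printing Implicit Defensive.

(** * Definable predicates *)

(* [mix a b = a 0, b 0, a 1, b 1, ...] *)
Fixpoint mix A (a b : nat -> A) n :=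
  match n with O => a 0 | S m => mix b (fun k => a (S k)) m end.

Lemma mix_l A (a b : nat -> A) k : mix a b (k + k) = a k.
Proof.
elim: k a b => // k IH a b.
by rewrite -plus_n_Sm /= IH.
Qed.

Lemma mix_r A (a b : nat -> A) k : mix a b (S (k + k)) = b k.
Proof. exact: mix_l. Qed.

Lemma mix_map A B (g : A -> B) (a b : nat -> A) n :
  g (mix a b n) = mix (fun k => g (a k)) (fun k => g (b k)) n.
Proof. by elim: n a b => // n IH a b /=; rewrite IH. Qed.

Lemma mix_ext A (a b a' b' : nat -> A) n :
  (forall k, a k = a' k) -> (forall k, b k = b' k) -> mix a b n = mix a' b' n.
Proof. by elim: n a b a' b' => //= n IH a b a' b' ha hb; apply: IH. Qed.

Lemma mix_all A (Q : A -> Prop) (a b : nat -> A) n :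
  (forall k, Q (a k)) -> (forall k, Q (b k)) -> Q (mix a b n).
Proof. by elim: n a b => //= n IH a b ha hb; apply: IH. Qed.

Fixpoint rename (r q : nat -> nat) (f : form) : form :=
  match f with
  | FIn i j => FIn (r i) (r j)
  | FEq i j => FEq (r i) (r j)
  | FInC i k => FInC (r i) (q k)
  | FBot => FBot
  | FImp g h => FImp (rename r q g) (rename r q h)
  | FAll g => FAll (rename (scons 0 (fun n => S (r n))) q g)
  end.

Lemma sat_rename (V : set_structure) (D : V -> Prop) f r q s c s' c' :
  (forall n, s (r n) = s' n) -> (forall n, c (q n) = c' n) ->
  sat D s c (rename r q f) <-> sat D s' c' f.
Proof.
move=> hs hc; elim: f r s s' hs => //=.
- by move=> i j r s s' hs; rewrite !hs.
- by move=> i j r s s' hs; rewrite !hs.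
- by move=> i j r s s' hs; rewrite hs hc.
- by move=> g IHg h IHh r s s' hs; rewrite (IHg _ _ _ hs) (IHh _ _ _ hs).
- move=> g IH r s s' hs.
  have E x : sat D (scons x s) c (rename (scons 0 (fun n => S (r n))) q g)
      <-> sat D (scons x s') c' g by apply: IH => -[|n] /=.
  by split=> H x hx; apply/E/H.
Qed.

(* Ranges of set and class quantifiers for which bounded quantification over a
   set or a class is quantification over sets. *)
Class frame (V : set_structure) (D K : V -> Prop) := {
  frame_set_ex : exists d, D d;
  frame_class_ex : exists k, K k;
  frame_set : forall a x, D a -> x ∈ a -> D x;
  frame_class : forall X x, K X -> x ∈ X -> D x
}.

Section Definability.
Context {V : set_structure} (D K : V -> Prop) {fr : frame D K}.

Notation env := (nat -> V).
Definition valid (e : env) := forall n, D (e n).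

(** A variable of [e] or a constant from [D], in one format: an even index [i] reads [e], an odd one
    reads [a]. *)
Definition term (t : env -> V) :=
  exists i a, D a /\ forall e, t e = mix e (fun _ => a) i.

(* The formula sees the variables [e] interleaved with finitely many relevant
   parameters [s], so that definable predicates can be combined without
   bookkeeping of free variables. *)
Definition definable (F : env -> Prop) :=
  exists f s c, valid s /\ (forall n, K (c n)) /\
    forall e, valid e -> (F e <-> sat D (mix e s) c f).

Lemma valid_scons x e : D x -> valid e -> valid (scons x e).
Proof. by move=> hx he [|n] /=. Qed.

Lemma term_valid t e : term t -> valid e -> D (t e).
Proof. by case=> i [a [ha ->]] he; apply: mix_all. Qed.

Lemma term_var k : term (fun e => e k).
Proof.
case: frame_set_ex => d hd.
by exists (k + k), d; split=> // e; rewrite mix_l.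
Qed.

Lemma term_cst a : D a -> term (fun _ => a).
Proof. by exists 1, a. Qed.

Lemma term_shift t : term t -> term (fun e => t (fun n => e (S n))).
Proof.
case=> i [a [ha ht]].
(* An even position, which holds a variable, moves to the next variable; an odd position, which
   holds the parameter, stays. *)
exists (mix (fun k => S k + S k) (fun k => S (k + k)) i), a; split=> // e.
rewrite ht (mix_map (mix e _)); apply: mix_ext => k; first by rewrite mix_l.
by rewrite mix_r.
Qed.

(* [r1] and [r2] redirect [mix e s1] and [mix e s2] into [mix e (mix s1 s2)]. *)
Let r1 := mix (fun k => k + k) (fun k => S ((k + k) + (k + k))).
Let r2 := mix (fun k => k + k) (fun k => S (S (k + k) + S (k + k))).

Let r1E e s1 s2 n : mix e (mix s1 s2) (r1 n) = mix e s1 n :> V.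
Proof.
rewrite /r1 (mix_map (mix e _)); apply: mix_ext => k; first by rewrite mix_l.
by rewrite mix_r mix_l.
Qed.

Let r2E e s1 s2 n : mix e (mix s1 s2) (r2 n) = mix e s2 n :> V.
Proof.
rewrite /r2 (mix_map (mix e _)); apply: mix_ext => k; first by rewrite mix_l.
by rewrite !mix_r.
Qed.

Lemma definable_ext F G :
  (forall e, valid e -> (F e <-> G e)) -> definable F -> definable G.
Proof.
move=> h [f [s [c [hs [hc hf]]]]]; exists f, s, c; do 2!split=> //.
by move=> e he; rewrite -(h e he) hf.
Qed.

Lemma definable_in t1 t2 :
  term t1 -> term t2 -> definable (fun e => t1 e ∈ t2 e).
Proof.
case=> i [a [ha h1]] [j [b [hb h2]]]; case: frame_class_ex => k0 hk0.
exists (FIn (r1 i) (r2 j)), (mix (fun _ => a) (fun _ => b)), (fun _ => k0).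
split; first by move=> n; apply: mix_all.
by split=> // e he /=; rewrite r1E r2E h1 h2.
Qed.

Lemma definable_eq t1 t2 :
  term t1 -> term t2 -> definable (fun e => t1 e = t2 e).
Proof.
case=> i [a [ha h1]] [j [b [hb h2]]]; case: frame_class_ex => k0 hk0.
exists (FEq (r1 i) (r2 j)), (mix (fun _ => a) (fun _ => b)), (fun _ => k0).
split; first by move=> n; apply: mix_all.
by split=> // e he /=; rewrite r1E r2E h1 h2.
Qed.

Lemma definable_inC t X : term t -> K X -> definable (fun e => t e ∈ X).
Proof.
case=> i [a [ha h1]] hX.
exists (FInC i 0), (fun _ => a), (fun _ => X).
by do 2!split=> //; move=> e he /=; rewrite h1.
Qed.

Lemma definable_False : definable (fun _ => False).
Proof.
case: frame_set_ex => d hd; case: frame_class_ex => k hk.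
by exists FBot, (fun _ => d), (fun _ => k); do 2!split=> //.
Qed.

Lemma definable_imp F G :
  definable F -> definable G -> definable (fun e => F e -> G e).
Proof.
case=> f [s [c [hs [hc hf]]]] [g [s' [c' [hs' [hc' hg]]]]].
exists (FImp (rename r1 (fun k => k + k) f) (rename r2 (fun k => S (k + k)) g)),
  (mix s s'), (mix c c').
split; first by move=> n; apply: mix_all.
split; first by move=> n; apply: mix_all.
move=> e he; rewrite (hf e he) (hg e he) /=.
have E1 : sat D (mix e (mix s s')) (mix c c') (rename r1 (fun k => k + k) f)
    <-> sat D (mix e s) c f.
  by apply: sat_rename => n; [apply: r1E | apply: mix_l].
have E2 : sat D (mix e (mix s s')) (mix c c')
    (rename r2 (fun k => S (k + k)) g) <-> sat D (mix e s') c' g.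
  by apply: sat_rename => n; [apply: r2E | apply: mix_r].
tauto.
Qed.

Lemma definable_allD (F : env -> V -> Prop) :
  definable (fun e => F (fun n => e (S n)) (e 0)) ->
  definable (fun e => forall x, D x -> F e x).
Proof.
case=> f [s [c [hs [hc hf]]]].
(* The quantifier puts its variable in front of [mix e s], while [f] expects it inside, as in
   [mix (scons x e) s]. The renaming converts between the two layouts. *)
exists (FAll (rename (mix (scons 0 (fun k => S (k + k))) (fun k => S (S (k + k))))
  (fun k => k) f)), s, c.
do 2!split=> //; move=> e he /=.
have E x : D x -> F e x <-> sat D (mix (scons x e) s) c f.
  by move=> hx; rewrite -hf //; apply: valid_scons.
set r : nat -> nat := mix _ _; have Er x : sat D (scons x (mix e s)) c
    (rename r (fun k => k) f) <-> sat D (mix (scons x e) s) c f.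
  apply: sat_rename => // n.
  rewrite (mix_map (scons x (mix e s))); apply: mix_ext => [[|k]|k] //=.
    by rewrite mix_l.
  exact: mix_r.
by split=> H x hx; [apply/Er/E | apply/E/Er] => //; apply: H.
Qed.

(** Quantifiers in the development range over all of [V]. The side condition says that instances
    outside [D] hold trivially, as they do for a quantifier bounded by a set or a class, so that the
    relativized quantifier has the same meaning. *)
Lemma definable_all (F : env -> V -> Prop) :
  (forall e x, valid e -> ~ D x -> F e x) ->
  definable (fun e => F (fun n => e (S n)) (e 0)) ->
  definable (fun e => forall x, F e x).
Proof.
move=> h /definable_allD; apply: definable_ext => e he; split=> H x //.
by case: (classic (D x)) => hx; [apply: H | apply: h].
Qed.

Lemma definable_not F : definable F -> definable (fun e => ~ F e).
Proof. by move=> h; apply: definable_imp h definable_False. Qed.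

Lemma definable_and F G :
  definable F -> definable G -> definable (fun e => F e /\ G e).
Proof.
move=> hF hG.
apply: definable_ext (definable_not (definable_imp hF (definable_not hG))).
by move=> e _; tauto.
Qed.

Lemma definable_or F G :
  definable F -> definable G -> definable (fun e => F e \/ G e).
Proof.
move=> hF hG.
apply: definable_ext (definable_imp (definable_not hF) hG).
by move=> e _; case: (classic (F e)); tauto.
Qed.

Lemma definable_iff F G :
  definable F -> definable G -> definable (fun e => F e <-> G e).
Proof. by move=> hF hG; apply: definable_and; apply: definable_imp. Qed.

Lemma definable_ex (F : env -> V -> Prop) :
  (forall e x, valid e -> F e x -> D x) ->
  definable (fun e => F (fun n => e (S n)) (e 0)) ->
  definable (fun e => exists x, F e x).
Proof.
move=> h /definable_not hF.
have := definable_not (definable_all (F := fun e x => ~ F e x) _ hF).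
move=> H; apply: definable_ext (H _) => [e he|e x he hx /(h e x he)//].
split; first by move/not_all_not_ex.
by case=> x hx /(_ x).
Qed.

Lemma definable_upair t x y : term t -> term x -> term y ->
  definable (fun e => is_upair (t e) (x e) (y e)).
Proof.
move=> ht hx hy; apply: definable_all => [e z he hz|].
  split=> [h|[] h]; case: hz; first exact: frame_set (term_valid ht he) h.
    by rewrite h; apply: term_valid.
  by rewrite h; apply: term_valid.
apply: definable_iff.
  by apply: definable_in; [apply: term_var | apply: term_shift].
apply: definable_or; apply: definable_eq; try exact: term_var;
  exact: term_shift.
Qed.

End Definability.

(** * Tactics that find the formulas *)

Ltac dom_tac D K := cbv beta;
  first
  [ assumption
  | exact I
  | match goal with
    | h : valid _ ?e |- _ => exact (h _)
    | h : mem ?x ?X |- _ =>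
      first [ refine (@frame_class _ D K _ X x _ h); assumption
            | refine (@frame_set _ D K _ X x _ h); dom_tac D K ]
    | h : term _ ?t |- _ =>
      refine (term_valid h _); intro; match goal with k : valid _ _ |- _ =>
        apply k end
    end ].

Ltac term_tac D K :=
  lazymatch goal with
  | |- term _ (fun e => e ?k) => exact (@term_var _ D K _ k)
  | h : term _ ?t |- term _ (fun e => ?t _) =>
    first [ exact h | exact (term_shift h) | exact (term_shift (term_shift h))
          | exact (term_shift (term_shift (term_shift h)))
          | exact (term_shift (term_shift (term_shift (term_shift h)))) ]
  | h : term _ ?t |- term _ ?t => exact h
  | |- term _ (fun _ => ?a) => apply (@term_cst _ D a); dom_tac D K
  end.

(** Quantifying over all terms builds in closure under substitution, so that a predicate known to be
    definable can serve as an atom of further formulas. *)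
Definition definable1 (V : set_structure) (D K : V -> Prop) (Q : V -> Prop) :=
  forall t, term D t -> definable D K (fun e => Q (t e)).

Definition definable2 (V : set_structure) (D K : V -> Prop)
    (Q : V -> V -> Prop) :=
  forall t u, term D t -> term D u -> definable D K (fun e => Q (t e) (u e)).

Lemma definable1_sat (V : set_structure) (D K : V -> Prop) {fr : frame D K} Q :
  definable1 D K Q -> exists f s c, valid D s /\ (forall n, K (c n)) /\
    forall x, D x -> (Q x <-> sat D (scons x s) c f).
Proof.
move=> /(_ _ (term_var 0)) [f [s [c [hs [hc hf]]]]].
case: (frame_set_ex (D := D)) => d hd.
(* The environments [mix (scons x _) s] and [scons x (mix s _)] list the same values, but agree only
   pointwise; the identity renaming exchanges them. *)
exists (rename (fun n => n) (fun n => n) f), (mix s (fun _ => d)), c.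
split; first by move=> n; apply: mix_all.
split=> // x hx.
have -> : Q x <-> sat D (mix (scons x (fun _ => d)) s) c f.
  by rewrite -hf //; apply: valid_scons => // n.
by symmetry; apply: sat_rename => // -[|n].
Qed.

(** The tactic [atom] treats the leaves that are not built in. This lets the lemmas on pairs and
    relations be proved by the same traversal before they become leaves themselves. *)
Ltac def_with atom D K :=
  let rec go := (cbv beta;
  lazymatch goal with
  | |- definable _ _ (fun e => @?F e <-> @?G e) =>
    apply (@definable_iff _ D K _ F G); go
  | |- definable _ _ (fun e => ~ @?F e) => apply (@definable_not _ D K _ F); go
  | |- definable _ _ (fun e => @?F e /\ @?G e) =>
    apply (@definable_and _ D K _ F G); go
  | |- definable _ _ (fun e => @?F e \/ @?G e) =>
    apply (@definable_or _ D K _ F G); go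
  | |- definable _ _ (fun e => @?F e -> @?G e) =>
    apply (@definable_imp _ D K F G); go
  | |- definable _ _ (fun e => exists x : _, @?F e x) =>
    apply (@definable_ex _ D K _ F);
    [ cbv beta; let h := fresh in
      intros ? ? ? h; decompose [and] h; dom_tac D K
    | go ]
  | |- definable _ _ (fun e => forall x : _, @?F e x) =>
    apply (@definable_all _ D K F);
    [ cbv beta; let h := fresh in
      intros ? ? ? h; intros; exfalso; apply h; dom_tac D K
    | go ]
  | |- definable _ _ (fun e => mem (@?s e) (@?t e)) =>
    first [ apply (@definable_in _ D K _ s t); term_tac D K
          | apply (@definable_inC _ D K s);
            [term_tac D K | first [assumption | exact I]] ]
  | |- definable _ _ (fun e => eq (@?s e) (@?t e)) =>
    apply (@definable_eq _ D K _ s t); term_tac D K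
  | |- definable _ _ (fun e => is_upair (@?t e) (@?x e) (@?y e)) =>
    apply (@definable_upair _ D K _ t x y); term_tac D K
  | |- _ => atom D K
  end) in go.

Section Pairs.
Context {V : set_structure} (D K : V -> Prop) {fr : frame D K}.

(** Both components of a Kuratowski pair are elements of it, so the existential quantifiers can be
    bounded by [t e]. *)
Lemma definable_opair t x y : term D t -> term D x -> term D y ->
  definable D K (fun e => is_opair (t e) (x e) (y e)).
Proof.
move=> ht hx hy.
have E : definable D K (fun e => exists a, a ∈ t e /\ exists b, b ∈ t e /\
    is_upair a (x e) (x e) /\ is_upair b (x e) (y e) /\ is_upair (t e) a b).
  def_with fail D K.
apply: definable_ext E => e he; split.
  by case=> a [_ [b [_ h]]]; exists a, b.
case=> a [b [h1 [h2 h3]]]; exists a; split; first by apply/h3; left.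
by exists b; split=> //; apply/h3; right.
Qed.

Lemma definable_rel R x y : K R -> term D x -> term D y ->
  definable D K (fun e => rel R (x e) (y e)).
Proof.
move=> hR hx hy; rewrite /rel.
have E : definable D K (fun e => exists t, t ∈ R /\ is_opair t (x e) (y e)).
  def_with ltac:(fun D K => match goal with
    | |- definable _ _ (fun e => is_opair (@?t e) (@?x e) (@?y e)) =>
      apply (@definable_opair t x y); term_tac D K
    end) D K.
by apply: definable_ext E => e he; split=> -[t []]; exists t.
Qed.

Lemma definable_rel_set r x y : term D r -> term D x -> term D y ->
  definable D K (fun e => rel (r e) (x e) (y e)).
Proof.
move=> hR hx hy; rewrite /rel.
have E : definable D K (fun e => exists t, t ∈ r e /\ is_opair t (x e) (y e)).
  def_with ltac:(fun D K => match goal with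
    | |- definable _ _ (fun e => is_opair (@?t e) (@?x e) (@?y e)) =>
      apply (@definable_opair t x y); term_tac D K
    end) D K.
by apply: definable_ext E => e he; split=> -[t []]; exists t.
Qed.

End Pairs.

Ltac atom_tac D K :=
  match goal with
  | |- definable _ _ (fun e => is_opair (@?t e) (@?x e) (@?y e)) =>
    apply (@definable_opair _ D K _ t x y); term_tac D K
  | |- definable _ _ (fun e => rel ?R (@?x e) (@?y e)) =>
    apply (@definable_rel _ D K _ R x y);
    [first [assumption | exact I] | term_tac D K | term_tac D K]
  | |- definable _ _ (fun e => rel (@?r e) (@?x e) (@?y e)) =>
    apply (@definable_rel_set _ D K _ r x y); term_tac D K
  | h : definable1 _ _ ?Q |- definable _ _ (fun e => ?Q (@?x e)) =>
    apply (h x); term_tac D K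
  | h : definable2 _ _ ?Q |- definable _ _ (fun e => ?Q (@?x e) (@?y e)) =>
    apply (h x y); term_tac D K
  end.

Ltac def_tac :=
  match goal with
  | |- definable ?D ?K _ => def_with atom_tac D K
  | |- definable1 ?D ?K _ =>
    let t := fresh "t" in let h := fresh "h" in
    intros t h; def_with atom_tac D K
  | |- definable2 ?D ?K _ =>
    let t := fresh "t" in let u := fresh "u" in
    let h := fresh "h" in let k := fresh "k" in
    intros t u h k; def_with atom_tac D K
  end.

(** * Sets and classes of a transitive model *)

Section Model.
Context {V : set_structure} (hV : ZFC V) {M C : V} (hM : ctm_GBminus M C).
Context {W : V} (hWC : W ∈ C).

Notation inM := (fun x : V => x ∈ M).
Notation inC := (fun X : V => X ∈ C).
Notation mdefinable1 := (definable1 inM inC).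
Notation mdefinable2 := (definable2 inM inC).

Let GB := ctm_model hM.

Lemma mem_set a x : a ∈ M -> x ∈ a -> x ∈ M.
Proof. by move=> ha; apply: (ctm_transitive hM). Qed.

Lemma mem_class X x : X ∈ C -> x ∈ X -> x ∈ M.
Proof. by move=> hX; apply: (ctm_classes hM). Qed.

Lemma model_inhabited : exists d, d ∈ M.
Proof. by case: (gb_infinity GB) => a [ha _]; exists a. Qed.

#[local] Instance frame_model : frame inM inC.
Proof.
split; [exact: model_inhabited | by exists W | exact: mem_set | exact: mem_class].
Qed.

Ltac mem_tac := let D := constr:(inM) in let K := constr:(inC) in dom_tac D K.

Lemma set_ext a b : (forall x, x ∈ a <-> x ∈ b) -> a = b :> V.
Proof. by move=> h; apply: (zfc_extensionality hV) => // x _; apply: h. Qed.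

(** The axiom schemas speak of elements of [M] only; by transitivity of the model this
    relativization disappears, here and in the versions of comprehension and collection below. *)
Lemma separation (Q : V -> Prop) a : mdefinable1 Q -> a ∈ M ->
  exists b, b ∈ M /\ forall x, x ∈ b <-> x ∈ a /\ Q x.
Proof.
case/definable1_sat => f [s [c [hs [hc hf]]]] ha.
case: (gb_separation GB f hs hc ha) => b [hb hbx]; exists b; split=> // x.
have E : x ∈ M -> (x ∈ b <-> x ∈ a /\ Q x).
  by move=> hx; rewrite (hbx x hx) hf.
by split=> h; apply/E => //; [mem_tac | case: h => h _; mem_tac].
Qed.

Lemma comprehension (Q : V -> Prop) : mdefinable1 Q ->
  exists X, X ∈ C /\ forall x, x ∈ X <-> x ∈ M /\ Q x.
Proof.
case/definable1_sat => f [s [c [hs [hc hf]]]].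
case: (gb_class_comprehension GB f hs hc) => X [hX hXx].
exists X; split=> // x.
have E : x ∈ M -> (x ∈ X <-> Q x) by move=> hx; rewrite (hXx x hx) hf.
split=> [h|[hx /E]]; last by apply.
have hx : x ∈ M by mem_tac.
by split=> //; apply/E.
Qed.

Lemma model_class : M ∈ C.
Proof.
have h : mdefinable1 (fun x => x = x) by def_tac.
case: (comprehension h) => X [hX hXx].
by have -> // : M = X by apply: set_ext => x; rewrite hXx; tauto.
Qed.

Let hMC := model_class.

Lemma collection (Q : V -> V -> Prop) a : mdefinable2 Q -> a ∈ M ->
  (forall x, x ∈ a -> exists y, y ∈ M /\ Q x y) ->
  exists b, b ∈ M /\ forall x, x ∈ a -> exists y, y ∈ b /\ Q x y.
Proof.
move=> /(_ _ _ (term_var 0) (term_var 1)) [f [s [c [hs [hc hf]]]]] ha htot.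
case: model_inhabited => d hd.
(* The collection schema has [x] and [y] in front, while the definability format interleaves them
   with the parameters; [r] translates positions from the latter to the former. *)
pose r : nat -> nat := mix (scons 0 (scons 1 (fun k => S (S (k + k)))))
  (fun k => S (S (S (k + k)))).
have E x y : x ∈ M -> y ∈ M -> Q x y <->
    sat inM (scons x (scons y (mix (fun _ => d) s))) c (rename r (fun n => n) f).
  move=> hx hy.
  have -> : Q x y <-> sat inM (mix (scons x (scons y (fun _ => d))) s) c f.
    by rewrite -hf //; do 2!apply: valid_scons => //.
  symmetry; apply: sat_rename => // n; rewrite /r.
  rewrite (mix_map (scons x (scons y (mix (fun _ => d) s)))).
  apply: mix_ext => [[|[|k]]|k] //=; first by rewrite mix_l.
  exact: mix_r.
have hs' n : mix (fun _ => d) s n ∈ M by exact: (mix_all (Q := inM)).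
case: (@gb_collection _ _ _ GB (rename r (fun n => n) f) _ _ hs' hc _ ha).
- move=> x hx /htot [y [hy hQ]]; exists y; split=> //; exact/E.
- move=> b [hb hbx]; exists b; split=> // x hx.
  have hxM : x ∈ M by mem_tac.
  by case: (hbx x hxM hx) => y [hy [hyb /E h]]; exists y; auto.
Qed.

(** [Q] may be partial while collection wants a total relation. So [Q] is relaxed to hold of
    anything at points without a value, and separation afterwards discards the spurious elements. *)
Lemma replacement (Q : V -> V -> Prop) a : mdefinable2 Q -> a ∈ M ->
  (forall x y y', x ∈ a -> y ∈ M -> y' ∈ M -> Q x y -> Q x y' -> y = y') ->
  exists b, b ∈ M /\
    forall y, y ∈ b <-> y ∈ M /\ exists x, x ∈ a /\ Q x y.
Proof.
move=> hQ ha hfun.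
have hQ1 : mdefinable2 (fun x y => (exists z, z ∈ M /\ Q x z) -> Q x y) by def_tac.
have hQ2 : mdefinable1 (fun y => exists x, x ∈ a /\ Q x y) by def_tac.
case: (collection hQ1 ha) => [x hx|c [hc hcx]].
  case: (classic (exists z, z ∈ M /\ Q x z)) => [[z [hz hxz]]|h].
    by exists z.
  by exists x; split=> //; mem_tac.
case: (separation hQ2 hc) => b [hb hbx]; exists b; split=> // y.
rewrite hbx; split=> -[hy [x [hx hxy]]].
  by split; [mem_tac | exists x].
split; last by exists x.
case: (hcx x hx) => z [hz hxz].
have hzM : z ∈ M by mem_tac.
by rewrite (hfun x y z) //; apply: hxz; exists y.
Qed.


(** * Foundation, pairs and unions *)

Lemma foundation (x a : V) : x ∈ a -> exists y, y ∈ a /\ forall z, z ∈ y -> z ∉ a.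
Proof.
move=> hx; case: (zfc_foundation hV (a := a) I) => [|y [_ [hy h]]].
  by exists x.
by exists y; split=> // z hz; apply: h.
Qed.

Lemma mem_irrefl (x : V) : x ∉ x.
Proof.
case: (zfc_pairing hV (a := x) (b := x) I I) => s [_ hs] hx.
have hxs : x ∈ s by apply/hs => //; left.
case: (foundation hxs) => y [/hs hy h].
have {}hy : y = x by case: hy.
by case: (h x); rewrite ?hy.
Qed.

Lemma upair_unique (t t' x y : V) : is_upair t x y -> is_upair t' x y -> t = t'.
Proof. by move=> h h'; apply: set_ext => z; rewrite h h'. Qed.

Lemma opair_unique (t t' x y : V) : is_opair t x y -> is_opair t' x y -> t = t'.
Proof.
case=> a [b [ha [hb ht]]] [a' [b' [ha' [hb' ht']]]].
rewrite -(upair_unique ha ha') -(upair_unique hb hb') in ht'.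
exact: upair_unique ht ht'.
Qed.

Lemma upair_inj (t x y y' : V) : is_upair t x y -> is_upair t x y' -> y = y'.
Proof.
move=> h h'; have /h' : y ∈ t by apply/h; right.
have /h : y' ∈ t by apply/h'; right.
by case=> [->|] //; case.
Qed.

Lemma opair_inj (t x y x' y' : V) :
  is_opair t x y -> is_opair t x' y' -> x = x' /\ y = y'.
Proof.
case=> a [b [ha [hb ht]]] [a' [b' [ha' [hb' ht']]]].
have xx' : x = x'.
  have /ht' [e|e] : a ∈ t by apply/ht; left.
    by have /ha' : x ∈ a' by [rewrite -e; apply/ha; left]; case.
  have /ha : x' ∈ a by rewrite e; apply/hb'; left.
  by case.
split=> //; subst x'.
rewrite -(upair_unique ha ha') in ht'.
have e := upair_inj ht ht'; rewrite -e in hb'.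
exact: upair_inj hb hb'.
Qed.

Lemma upair_ex x y : x ∈ M -> y ∈ M -> exists t, t ∈ M /\ is_upair t x y.
Proof.
move=> hx hy; case: (gb_pairing GB hx hy) => t [ht h]; exists t; split=> // z.
split=> hz; first by apply/h => //; mem_tac.
by apply/h => //; case: hz => ->.
Qed.

Lemma opair_ex x y : x ∈ M -> y ∈ M -> exists t, t ∈ M /\ is_opair t x y.
Proof.
move=> hx hy; case: (upair_ex hx hx) => a [ha hax].
case: (upair_ex hx hy) => b [hb hbx].
case: (upair_ex ha hb) => t [ht htx].
by exists t; split=> //; exists a, b.
Qed.

Lemma opair_mem t x y : t ∈ M -> is_opair t x y -> x ∈ M /\ y ∈ M.
Proof.
move=> ht [a [b [_ [hb htb]]]].
have hbt : b ∈ t by apply/htb; right.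
have hbM : b ∈ M by mem_tac.
by split; apply: (mem_set hbM); apply/hb; [left | right].
Qed.

Lemma rel_mem R x y : R ∈ C -> rel R x y -> x ∈ M /\ y ∈ M.
Proof. by move=> hR [t [ht htR]]; apply: opair_mem ht; mem_tac. Qed.

Lemma set_union a : a ∈ M -> exists b, b ∈ M /\
  forall x, x ∈ b <-> exists y, y ∈ a /\ x ∈ y.
Proof.
move=> ha; case: (gb_union GB ha) => b [hb hbx]; exists b; split=> // x.
split=> [hx|[y [hy hx]]].
  have hxM : x ∈ M by mem_tac.
  by case/(hbx x hxM): hx => y [_ h]; exists y.
have hyM : y ∈ M by mem_tac.
by apply/hbx; [mem_tac | exists y].
Qed.

Lemma comprehension2 (Q : V -> V -> Prop) : mdefinable2 Q ->
  exists X, X ∈ C /\ forall x y, rel X x y <-> x ∈ M /\ y ∈ M /\ Q x y.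
Proof.
move=> hQ.
have : mdefinable1 (fun t => exists x, x ∈ M /\ exists y, y ∈ M /\
    is_opair t x y /\ Q x y) by def_tac.
case/comprehension => X [hX h]; exists X; split=> // x y; split.
  case=> t [ht /h [_ [x' [hx' [y' [hy' [ht' hQ']]]]]]].
  by case: (opair_inj ht ht') => -> ->.
case=> hx [hy hxy]; case: (opair_ex hx hy) => t [ht htx].
by exists t; split=> //; apply/h; split=> //; exists x; split=> //; exists y.
Qed.

Lemma singleton_ex x : x ∈ M -> exists s, s ∈ M /\ forall z, z ∈ s <-> z = x.
Proof.
move=> hx; case: (upair_ex hx hx) => s [hs h]; exists s; split=> // z.
by rewrite h; tauto.
Qed.

Lemma model_not_set : M ∉ M.
Proof. exact: mem_irrefl. Qed.

(** The graph [G] of the isomorphism between [W] and the ordinals is a set of [V] that need not be a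
    class of the model, so separation for formulas mentioning it has to take place in [V]. *)
#[local] Instance frame_universe :
  frame (fun _ : V => True) (fun _ : V => True).
Proof. by split=> //; exists M. Qed.

Lemma universe_separation (Q : V -> Prop) (a : V) :
  definable1 (fun _ => True) (fun _ => True) Q ->
  exists b, forall x, x ∈ b <-> x ∈ a /\ Q x.
Proof.
case/definable1_sat => f [s [c [hs [hc hf]]]].
case: (@zfc_separation _ hV f s c hs hc a I) => b [_ h].
by exists b => x; rewrite h // hf.
Qed.

Context (hwo : well_orders M (rel W)).

Lemma least_ex (Q : V -> Prop) : mdefinable1 Q -> (exists x, x ∈ M /\ Q x) ->
  exists x, x ∈ M /\ Q x /\ forall y, y ∈ M -> Q y -> ~ rel W y x.
Proof.
case/comprehension => X [hX h] [x hx].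
case: (wo_least hwo (S := X)) => [y hy||y [/h [hy hQ] hmin]].
- by mem_tac.
- by exists x; apply/h.
- by exists y; do 2!split=> //; move=> z hz hQz; apply/hmin/h.
Qed.

Context {O : V} {f : V -> V} {G : V} (hO : is_Ord_of M O) (hG : graph1 M f G)
  (hf : bijective_between M f O)
  (hfW : forall x y, x ∈ M -> y ∈ M -> (rel W x y <-> f x ∈ f y)).

(** * Ordinals of the model and recursion along them *)

(** A bounded formula for being an ordinal. The least-element clause of [well_orders] quantifies
    over arbitrary subsets in [V]; foundation makes it automatic for membership. *)
Definition transitive_linear (a : V) :=
  (forall x, x ∈ a -> forall y, y ∈ x -> y ∈ a) /\
  (forall x, x ∈ a -> forall y, y ∈ x -> forall z, z ∈ y -> z ∈ x) /\
  (forall x, x ∈ a -> forall y, y ∈ a -> x ∈ y \/ x = y \/ y ∈ x).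

Lemma ordinalE (a : V) : ordinal a <-> transitive_linear a.
Proof.
split=> [[ht hw]|[h1 [h2 h3]]].
  split; first by move=> x hx y hy; apply: ht hy.
  split; last by move=> x hx y hy; apply: (wo_total hw).
  move=> x hx y hy z hz; have hya := ht _ hx _ hy; have hza := ht _ hya _ hz.
  exact: (wo_trans hw hza hya hx).
split; first by move=> x hx y hy; apply: h1 hy.
split.
- by move=> x _; apply: mem_irrefl.
- by move=> x y z hx hy hz hxy hyz; apply: h2 hxy.
- by move=> x y hx hy; apply: h3.
- move=> s hs [x /foundation [y [hy h]]]; exists y; split=> // z hz hzy.
  exact: h hzy hz.
Qed.

Lemma ord_mem a : a ∈ O -> a ∈ M.
Proof. by case/hO. Qed.

Lemma Ord_class : O ∈ C.
Proof.
have h : mdefinable1 transitive_linear.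
  by rewrite /transitive_linear; def_tac.
case: (comprehension h) => X [hX hXx].
have -> // : O = X.
by apply: set_ext => x; rewrite (hO x) hXx ordinalE.
Qed.

Let hOC := Ord_class.

Lemma ord_downward a b : a ∈ O -> b ∈ a -> b ∈ O.
Proof.
move=> haO hb; have ha := ord_mem haO.
case/hO: haO => _ /ordinalE [h1 [h2 h3]]; apply/hO; split; first by mem_tac.
apply/ordinalE; split; first exact: h2.
split=> [x hx|x hx y hy]; first by apply: h2; apply: h1 hx.
by apply: h3; [apply: h1 hx | apply: h1 hy].
Qed.

(** Comparability is transported from the linear order [W] along [f], which maps [M] onto [O]. *)
Lemma ord_linear a b : a ∈ O -> b ∈ O -> a ∈ b \/ a = b \/ b ∈ a.
Proof.
case: hf => _ [_ hs] /hs [x [hx <-]] /hs [y [hy <-]].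
by case: (wo_total hwo hx hy) => [|[->|]]; rewrite ?hfW; auto.
Qed.

(** The counterexamples must form a class before class foundation applies, hence the restriction to
    definable properties. *)
Lemma ord_ind (Q : V -> Prop) : mdefinable1 Q ->
  (forall a, a ∈ O -> (forall b, b ∈ a -> Q b) -> Q a) ->
  forall a, a ∈ O -> Q a.
Proof.
move=> hQ hind a ha; apply: NNPP => hna.
have : mdefinable1 (fun a => a ∈ O /\ ~ Q a) by def_tac.
case/comprehension=> X [hX hXx].
have haM := ord_mem ha.
case: (gb_class_foundation GB hX) => [|b [hbM [/hXx [_ [hb hnb]] hmin]]].
  by exists a; split=> //; apply/hXx.
apply: hnb; apply: hind => // c hc; apply: NNPP => hnc.
have hcO := ord_downward hb hc; have hcM := ord_mem hcO.
by apply: (hmin c) => //; apply/hXx.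
Qed.

(** Burali-Forti: a set [O] in [M] would be an ordinal of the model and so a member of itself. *)
Lemma Ord_not_set : O ∉ M.
Proof.
move=> h; apply: (@mem_irrefl O); apply/hO; split=> //; apply/ordinalE.
split=> [x hx y|]; first exact: ord_downward.
split=> [x /hO [_ /ordinalE [h1 _]] y hy z|x hx y hy]; first exact: h1.
exact: ord_linear.
Qed.

Section Recursion.
Context (T N : V) (hT : T ∈ C) (hN : N ∈ C).

(* [g] is the part of the recursive function defined below [a]; its next value is
   the [W]-least [y ∈ T] to which all its values are [N]-related. *)
Definition candidate (g a y : V) :=
  y ∈ T /\ forall b, b ∈ a -> forall z, z ∈ M -> rel g b z -> rel N z y.

Definition next (g a y : V) :=
  candidate g a y /\ forall y', y' ∈ M -> candidate g a y' -> ~ rel W y' y.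

(** Approximations that are sets let the recursion be defined with set quantifiers only. An attempt
    may have no value at some [b ∈ a], namely when no candidate is left there. *)
Let attempt (a g : V) :=
  forall b, b ∈ a -> forall y, y ∈ M -> (rel g b y <-> next g b y).

Let next_ext g g' a y :
  (forall b, b ∈ a -> forall z, z ∈ M -> (rel g b z <-> rel g' b z)) ->
  next g a y <-> next g' a y.
Proof.
move=> h; have E z : candidate g a z <-> candidate g' a z.
  by split=> -[hz hN']; split=> // b hb u hu hr; apply: (hN' b hb u hu);
    apply/h.
by split=> -[/E h1 h2]; split=> // z hz /E; apply: h2.
Qed.

Let ord_trans a b c : a ∈ O -> b ∈ a -> c ∈ b -> c ∈ a.
Proof. by case/hO=> _ [h _] hb hc; apply: h hc. Qed.

Let attempt_unique a g a' g' : a ∈ O -> a' ∈ O -> g ∈ M -> g' ∈ M ->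
  attempt a g -> attempt a' g' ->
  forall b, b ∈ O -> b ∈ a -> b ∈ a' ->
  forall y, y ∈ M -> (rel g b y <-> rel g' b y).
Proof.
move=> ha ha' hg hg' hat hat'.
have haM := ord_mem ha; have haM' := ord_mem ha'.
apply: ord_ind; first by def_tac.
move=> b _ IH hb hb' y hy; rewrite (hat b hb y hy) (hat' b hb' y hy).
apply: next_ext => c hc z hz.
by apply: IH => //; [apply: ord_trans hb hc | apply: ord_trans hb' hc].
Qed.

Let value (a y : V) := exists g, g ∈ M /\ attempt a g /\ next g a y.

Let value_def : mdefinable2 value.
Proof.
by rewrite /value /attempt /next /candidate; def_tac.
Qed.

Let value_fun a y y' :
  a ∈ O -> y ∈ M -> y' ∈ M -> value a y -> value a y' -> y = y'.
Proof.
move=> ha hy hy' [g [hg [hat [h1 h2]]]] [g' [hg' [hat' hn']]].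
have E : next g' a y' <-> next g a y'.
  apply: next_ext => b hb.
  by apply: (attempt_unique ha ha) => //; apply: ord_downward ha hb.
case/E: hn' => h1' h2'.
by case: (wo_total hwo hy hy') => [h|[//|h]]; [case: (h2' y) | case: (h2 y')].
Qed.

Let attempt_value a g b y : a ∈ O -> g ∈ M -> attempt a g -> b ∈ a -> y ∈ M ->
  (rel g b y <-> value b y).
Proof.
move=> ha hg hat hb hy; rewrite (hat b hb y hy).
have hat' : attempt b g by move=> c hc; apply: hat; apply: ord_trans hb hc.
split=> [h|[g' [hg' [hat'' hn]]]]; first by exists g.
have hbO := ord_downward ha hb.
have E : next g' b y <-> next g b y.
  apply: next_ext => c hc.
  by apply: (attempt_unique hbO ha) => //;
    [apply: ord_downward hbO hc | apply: ord_trans hb hc].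
exact/E.
Qed.

(** Replacement collects the pairs of each [b ∈ a] with its value, if any. By induction there is an
    attempt up to [b]; it agrees with the collected set below [b], which gives the recursion clause
    at [b]. *)
Let attempt_ex a : a ∈ O -> exists g, g ∈ M /\ attempt a g.
Proof.
move: a; apply: ord_ind; first by rewrite /attempt /next /candidate; def_tac.
move=> a ha IH; have haM := ord_mem ha.
have hdef : mdefinable2 (fun b t => exists y, y ∈ M /\ is_opair t b y /\ value b y).
  by have hvd := value_def; def_tac.
case: (replacement hdef haM) => [b t t' hb ht ht'|g [hg hgt]].
  move=> [y [hy [hty hv]]] [y' [hy' [hty' hv']]].
  have hbO := ord_downward ha hb.
  rewrite (value_fun hbO hy hy' hv hv') in hty.
  exact: opair_unique hty hty'.
have E b y : b ∈ a -> y ∈ M -> rel g b y <-> value b y.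
  move=> hb hy; split.
    case=> t [ht /hgt [_ [b' [_ [y' [_ [ht' hv]]]]]]].
    by case: (opair_inj ht ht') => -> ->.
  move=> hv; have hbM : b ∈ M by mem_tac.
  case: (opair_ex hbM hy) => t [ht hby]; exists t; split=> //.
  by apply/hgt; split=> //; exists b; split=> //; exists y.
exists g; split=> // b hb y hy; rewrite E //.
case: (IH b hb) => g' [hg' hat'].
have hbO := ord_downward ha hb.
have Eb : next g b y <-> next g' b y.
  apply: next_ext => c hc z hz.
  have hca := ord_trans ha hb hc.
  by rewrite E // (attempt_value hbO hg' hat').
rewrite Eb; split=> [[g'' [hg'' [hat'' hn]]]|h]; last by exists g'.
have E'' : next g'' b y <-> next g' b y.
  apply: next_ext => c hc.
  by apply: (attempt_unique hbO hbO) => //; apply: ord_downward hbO hc.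
exact/E''.
Qed.

(* [F] is partial: once [T] has no candidate left, [F] is undefined from there on. *)
Lemma recursion : exists F, F ∈ C /\
  (forall a y, rel F a y -> a ∈ O /\ y ∈ M) /\
  forall a y, a ∈ O -> y ∈ M -> (rel F a y <-> next F a y).
Proof.
have : mdefinable2 (fun a y => a ∈ O /\ value a y) by have hvd := value_def; def_tac.
case/comprehension2 => F [hF hFx]; exists F; split=> //.
split=> [a y /hFx [_ [hy [ha _]]] //|a y ha hy].
have -> : rel F a y <-> value a y.
  by rewrite hFx; split=> [[_ [_ []]] //|]; have := ord_mem ha.
have E g : g ∈ M -> attempt a g -> next g a y <-> next F a y.
  move=> hg hat; apply: next_ext => b hb z hz; rewrite hFx.
  rewrite (attempt_value ha hg hat) //; have hbO := ord_downward ha hb.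
  have := ord_mem hbO; tauto.
split=> [[g [hg [hat /(E g hg hat)]]] //|h].
by case: (attempt_ex ha) => g [hg hat]; exists g; do 2!split=> //; apply/E.
Qed.

End Recursion.

Section RecursionFacts.
Context (T N F : V) (hT : T ∈ C) (hN : N ∈ C) (hF : F ∈ C).
Context (hFd : forall a y, rel F a y -> a ∈ O /\ y ∈ M)
  (hFE : forall a y, a ∈ O -> y ∈ M -> (rel F a y <-> next T N F a y)).

Lemma recursion_next a y : rel F a y -> next T N F a y.
Proof. by move=> h; case: (hFd h) => ha hy; apply/hFE. Qed.

Lemma recursion_fun a y y' : rel F a y -> rel F a y' -> y = y'.
Proof.
move=> h h'; case: (hFd h) => _ hy; case: (hFd h') => _ hy'.
case/recursion_next: h => h1 h2; case/recursion_next: h' => h1' h2'.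
by case: (wo_total hwo hy hy') => [h|[//|h]]; [case: (h2' y) | case: (h2 y')].
Qed.

Lemma recursion_ordered a y b z : rel F a y -> rel F b z -> b ∈ a -> rel N z y.
Proof.
move=> h h' hb; case: (hFd h') => _ hz.
by case/recursion_next: h => [[_ h] _]; apply: h hb _ hz h'.
Qed.

(** A value taken at two different, hence comparable, indices would be [N]-related to itself. *)
Lemma recursion_inj a b y : (forall x, x ∈ T -> ~ rel N x x) ->
  rel F a y -> rel F b y -> a = b.
Proof.
move=> hirr h h'; case: (hFd h) => ha _; case: (hFd h') => hb _.
have hyT : y ∈ T by case/recursion_next: h => [[]].
by case: (ord_linear ha hb) => [hab|[//|hab]]; case: (hirr y hyT);
  [apply: recursion_ordered h' h hab | apply: recursion_ordered h h' hab].
Qed.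

Lemma recursion_total a : a ∈ O -> (exists y, candidate T N F a y) ->
  exists y, rel F a y.
Proof.
move=> ha [y hy]; have haM := ord_mem ha.
have hdef : mdefinable1 (candidate T N F a) by rewrite /candidate; def_tac.
case: (least_ex hdef) => [|z [hz [h1 h2]]].
  by exists y; split=> //; case: hy => hyT _; mem_tac.
by exists z; apply/hFE.
Qed.

Lemma recursion_range a : a ∈ O ->
  exists s, s ∈ M /\ forall y, y ∈ s <-> exists b, b ∈ a /\ rel F b y.
Proof.
move=> ha; have haM := ord_mem ha.
have hdef : mdefinable2 (rel F) by def_tac.
case: (replacement hdef haM) => [x y y' _ _ _|s [hs h]].
  exact: recursion_fun.
exists s; split=> // y; rewrite h; split=> [[]//|[b [hb hy]]].
by split; [case: (hFd hy) | exists b].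
Qed.

End RecursionFacts.

(* Each value of the enumeration is the [W]-least element of [A] not yet
   enumerated. *)
Lemma enumeration A : A ∈ C -> A ∉ M -> exists F, F ∈ C /\
  (forall a y, rel F a y -> a ∈ O /\ y ∈ A) /\
  (forall a y y', rel F a y -> rel F a y' -> y = y') /\
  (forall a b y, rel F a y -> rel F b y -> a = b) /\
  (forall a, a ∈ O -> exists y, rel F a y) /\
  (forall a y z, rel F a y -> z ∈ A -> (forall b, b ∈ a -> ~ rel F b z) ->
    ~ rel W z y).
Proof.
move=> hA hAM.
have : mdefinable2 (fun x y => x <> y) by def_tac.
case/comprehension2 => N [hN hNx].
case: (recursion hA hN) => F [hF [hFd hFE]]; exists F; split=> //.
split=> [a y h|].
  split; first by case: (hFd _ _ h).
  by case: (recursion_next hFd hFE h) => [[]].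
split; first exact: recursion_fun hFd hFE.
split.
  move=> a b y; apply: (recursion_inj hFd hFE) => x _ /hNx [_ [_ []]] //.
split=> [a ha|a y z h hz hb].
  (* If no candidate were left at [a], then [A] would be the range of [F] below [a], which is a
     set. *)
  apply: (recursion_total hA hN hF hFE ha); apply: NNPP => hn; case: hAM.
  case: (recursion_range hF hFd hFE ha) => s [hs hsx].
  have -> // : A = s; apply: set_ext => y; rewrite hsx; split=> [hy|].
    apply: NNPP => hy'; case: hn; exists y; split=> // b hb z hz hbz.
    apply/hNx; do 2!split=> //; first by mem_tac.
    by move=> e; subst z; case: hy'; exists b.
  by case=> b [_ /(recursion_next hFd hFE) [[]]].
case: (recursion_next hFd hFE h) => _; apply; first by mem_tac.
split=> // b hb' u hu hbu; apply/hNx; do 2!split=> //; first by mem_tac.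
by move=> e; subst u; case: (hb b).
Qed.

(* An increasing map from the ordinals of the model cannot be bounded by [x], as
   its composition with [f] would embed the ordinals into [f x]. *)
Lemma model_enumeration : exists F, F ∈ C /\
  (forall a y, rel F a y -> a ∈ O /\ y ∈ M) /\
  (forall a y y', rel F a y -> rel F a y' -> y = y') /\
  (forall x, x ∈ M -> exists a, rel F a x).
Proof.
case: (enumeration model_class model_not_set) => F [hF [hFd [hff [hfi [hft hfm]]]]].
exists F; split=> //; split=> //; split=> // x hx; apply: NNPP => hn.
have hbelow a y : rel F a y -> rel W y x.
  move=> h; case: (hFd _ _ h) => ha hy.
  case: (wo_total hwo hy hx) => [//|[e|h']]; first by subst y; case: hn; exists a.
  case: (hfm a y x h hx) => // b _ hbx; by case: hn; exists b.
have hincr a b y z : rel F a y -> rel F b z -> b ∈ a -> rel W z y.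
  move=> h h' hb; case: (hFd _ _ h) => ha hy; case: (hFd _ _ h') => hb' hz.
  case: (wo_total hwo hy hz) => [hyz|[e|//]].
    case: (hfm b z y h' hy) => // c hc hcy.
    have e : c = a := hfi _ _ _ hcy h; subst c.
    case/hO: ha => _ /ordinalE [h1 [h2 h3]].
    exact: (mem_irrefl (h1 _ hb _ hc)).
  subst z; have e := hfi _ _ _ h h'; subst b; by case: (@mem_irrefl a).
(* [S] will consist of the ordinals moved downward by the increasing map [f ∘ F]. It contains [f x],
   because all values of [F] lie below [x]; but if [a] is a minimal element, then [f (F a)] is a
   smaller one. *)
have hdef : definable1 (fun _ => True) (fun _ => True)
    (fun a => exists z, rel F a z /\ exists u, rel G z u /\ u ∈ a).
  by def_tac.
case: (universe_separation O hdef) => S hS.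
have hGf z u : z ∈ M -> rel G z u <-> u = f z.
  move=> hz; split=> [[t [ht /hG [z' [hz' ht']]]]|->].
    by case: (opair_inj ht ht') => -> ->.
  have hfz : f z ∈ M by apply: ord_mem; case: hf => h _; apply: h.
  case: (opair_ex hz hfz) => t [_ ht]; exists t; split=> //.
  by apply/hG; exists z.
have hSE a z : rel F a z -> a ∈ S <-> f z ∈ a.
  move=> haz; case: (hFd _ _ haz) => ha hz; rewrite hS; split.
    case=> _ [z' [haz' [u [/hGf h hu]]]]; rewrite -(hff _ _ _ haz haz') in h.
    by rewrite -h.
  by move=> hfz; split=> //; exists z; split=> //; exists (f z); rewrite hGf.
have hfx : f x ∈ O by case: hf => h _; apply: h.
case: (hft _ hfx) => z hz.
have hxS : f x ∈ S.
  by apply/(hSE _ _ hz)/hfW => //; [case: (hFd _ _ hz) | apply: hbelow hz].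
case: (foundation hxS) => a [haS hmin].
have ha : a ∈ O by case/hS: haS.
case: (hft _ ha) => y hy; case: (hFd _ _ hy) => _ hyM.
have hya : f y ∈ a by apply/(hSE _ _ hy).
have hyO := ord_downward ha hya.
case: (hft _ hyO) => y' hy'; case: (hFd _ _ hy') => _ hyM'.
apply: (hmin _ hya); apply/(hSE _ _ hy')/hfW => //.
exact: hincr hy hy' hya.
Qed.

(** * The forcing order: maximal antichains and density *)

Context (P R : V) (hP : class_forcing C P R) (hanti : antisymmetric P R).

Let hPC := cf_domain hP.
Let hRC := cf_order hP.

Let refl p : p ∈ P -> rel R p p.
Proof. exact: (cf_refl hP). Qed.

Let trans p q r : p ∈ P -> q ∈ P -> r ∈ P -> rel R p q -> rel R q r -> rel R p r.
Proof. exact: (cf_trans hP). Qed.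

(** Recursion with incompatibility as [N] yields an antichain, which the [Ord]-cc makes a set. If
    some [u] were incompatible with all of it, [u] would remain a candidate forever and the
    recursion would run through [O]; replacement along the inverse of this injective enumeration
    would then make [O] a set. *)
Lemma predense_set U : Ord_cc M C P R -> U ∈ C -> incl U P ->
  (forall p q, p ∈ U -> q ∈ P -> rel R q p -> q ∈ U) ->
  exists A, A ∈ M /\ incl A U /\
    forall u, u ∈ U -> exists a, a ∈ A /\ ~ incompatible P R a u.
Proof.
move=> hcc hU hUP hdown.
have : mdefinable2 (incompatible P R) by rewrite /incompatible; def_tac.
case/comprehension2 => N [hN hNx].
case: (recursion hU hN) => F [hF [hFd hFE]].
have : mdefinable1 (fun y => exists a, a ∈ O /\ rel F a y) by def_tac.
case/comprehension => A [hA hAx].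
have hAU : incl A U.
  by move=> y /hAx [_ [a [_ /(recursion_next hFd hFE) [[]]]]].
have hAM : A ∈ M.
  apply: hcc => //; split=> [y hy|p q /hAx [_ [a [ha hp]]] /hAx [_ [b [hb hq]]] ne].
    by apply/hUP/hAU.
  case: (ord_linear ha hb) => [hab|[e|hab]].
      by case/hNx: (recursion_ordered hFd hFE hq hp hab) => _ [].
    by subst b; case: ne; apply: recursion_fun hFd hFE _ _ _ hp hq.
  case/hNx: (recursion_ordered hFd hFE hp hq hab) => _ [_ h] [r [h1 [h2 h3]]].
  by apply: h; exists r.
exists A; split=> //; split=> // u hu; apply: NNPP => hn.
have hinc a : a ∈ A -> incompatible P R a u.
  by move=> ha; apply: NNPP => h; apply: hn; exists a.
have htot a : a ∈ O -> exists y, rel F a y.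
  move=> ha; apply: (recursion_total hU hN hF hFE ha); exists u; split=> //.
  move=> b hb z hz hbz; apply/hNx; do 2!split=> //; first by mem_tac.
  by apply: hinc; apply/hAx; split=> //; exists b; split=> //; case: (hFd _ _ hbz).
have hdef : mdefinable2 (fun y a => rel F a y) by def_tac.
have hirr x : x ∈ U -> ~ rel N x x.
  by move=> /hUP hx /hNx [_ [_ h]]; apply: h; exists x; have := refl hx; auto.
case: (replacement hdef hAM) => [y a b _ _ _|s [hs hsx]].
  exact: recursion_inj hFd hFE _ _ _ hirr.
apply: Ord_not_set; have -> // : O = s; apply: set_ext => a; rewrite hsx; split.
  move=> ha; split; first exact: ord_mem.
  case: (htot a ha) => y hy; exists y; split=> //; apply/hAx.
  by case: (hFd _ _ hy) => _ hyM; split=> //; exists a.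
by case=> _ [y [_ /hFd []]].
Qed.

Definition dense_below (Q : V -> Prop) (p : V) :=
  forall q, q ∈ P -> rel R q p -> exists r, r ∈ P /\ rel R r q /\ Q r.

Lemma dense_below_here (Q : V -> Prop) p : p ∈ P ->
  (forall r, r ∈ P -> rel R r p -> Q r) -> dense_below Q p.
Proof. by move=> hp h q hq hqp; exists q; split=> //; split;
  [apply: refl | apply: h]. Qed.

Lemma dense_below_bind (Q Q' : V -> Prop) p : p ∈ P -> dense_below Q p ->
  (forall q, q ∈ P -> rel R q p -> Q q -> dense_below Q' q) -> dense_below Q' p.
Proof.
move=> hp h hb q hq hqp; case: (h q hq hqp) => r [hr [hrq hQ]].
have hrp := trans hr hq hp hrq hqp.
case: (hb r hr hrp hQ r hr (refl hr)) => s [hs [hsr hQ']].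
by exists s; split=> //; split=> //; apply: trans hsr hrq.
Qed.

(** * Completions from forcing relations *)

(* [c ∈ D0] is a code of the regular open class [{p | rel F c p}]. *)
Section Build.
Context (D0 F : V) (hD0 : D0 ∈ C) (hF : F ∈ C).
Context (hdown : forall c p q, c ∈ D0 -> p ∈ P -> q ∈ P -> rel R q p ->
    rel F c p -> rel F c q)
  (hreg : forall c p, c ∈ D0 -> p ∈ P -> dense_below (rel F c) p -> rel F c p).

Definition representable (Z : V -> Prop) :=
  exists c, c ∈ D0 /\ forall p, p ∈ P -> (rel F c p <-> Z p).

(** These closure properties suffice: binary joins are suprema of sets with at most two elements,
    zero is the supremum of the empty set, and meets and one follow by complementation. *)
Context (hcone : forall p, p ∈ P -> representable (fun q => rel R q p))
  (hcompl : forall c, c ∈ D0 ->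
    representable (fun p => forall q, q ∈ P -> rel R q p -> ~ rel F c q))
  (hsup : forall A, A ∈ M -> incl A D0 ->
    representable (dense_below (fun r => exists a, a ∈ A /\ rel F a r))).

(** Codes of the same class have to be identified, but they may form a proper class; the [W]-least
    code stands for all of them. *)
Let canonical c := c ∈ D0 /\ forall c', c' ∈ D0 ->
  (forall p, p ∈ P -> (rel F c' p <-> rel F c p)) -> ~ rel W c' c.

(** The operations of [ba_data] are total functions, so the canonical code is picked by [epsilon];
    [M] only witnesses that [V] is inhabited. For a representable [Z] the choice is forced. *)
Let code (Z : V -> Prop) : V :=
  epsilon (inhabits M) (fun c => canonical c /\
    forall p, p ∈ P -> (rel F c p <-> Z p)).

Let canonical_def : mdefinable1 canonical.
Proof. by rewrite /canonical; def_tac. Qed.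

Let canonical_D0 c : canonical c -> c ∈ D0.
Proof. by case. Qed.

Let codeP Z : representable Z ->
  canonical (code Z) /\ forall p, p ∈ P -> (rel F (code Z) p <-> Z p).
Proof.
case=> c0 [hc0 hc0Z].
apply: (epsilon_spec (inhabits M) (fun c => canonical c /\
  forall p, p ∈ P -> (rel F c p <-> Z p))).
have hc0M : c0 ∈ M by mem_tac.
have hdef : mdefinable1 (fun c => c ∈ D0 /\
    forall p, p ∈ P -> (rel F c p <-> rel F c0 p)) by def_tac.
case: (least_ex hdef) => [|c [hcM [[hc hcE] hmin]]]; first by exists c0.
exists c; split=> [|p hp]; last by rewrite hcE // hc0Z.
split=> // c' hc' h; apply: hmin; first by mem_tac.
by split=> // p hp; rewrite h // hcE.
Qed.

Let canonical_eq c c' : canonical c -> canonical c' ->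
  (forall p, p ∈ P -> (rel F c p <-> rel F c' p)) -> c = c'.
Proof.
move=> [hc h] [hc' h'] E.
have hcM : c ∈ M by mem_tac.
have hcM' : c' ∈ M by mem_tac.
have E' p : p ∈ P -> (rel F c' p <-> rel F c p) by move=> hp; rewrite E.
by case: (wo_total hwo hcM hcM') => [hw|[//|hw]]; [case: (h' c) | case: (h c')].
Qed.

Let representable_ext Z Z' : (forall p, p ∈ P -> (Z p <-> Z' p)) ->
  representable Z -> representable Z'.
Proof. by move=> h [c [hc hZ]]; exists c; split=> // p hp; rewrite -h // hZ. Qed.

Let rep_compl Z : representable Z ->
  representable (fun p => forall q, q ∈ P -> rel R q p -> ~ Z q).
Proof.
case=> c [hc hZ]; apply: representable_ext (hcompl hc) => p hp.
by split=> h q hq hqp; have := h q hq hqp; rewrite hZ.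
Qed.

Let rep_join Z Z' : representable Z -> representable Z' ->
  representable (dense_below (fun p => Z p \/ Z' p)).
Proof.
case=> c [hc hZ] [c' [hc' hZ']].
have hcM : c ∈ M by mem_tac.
have hcM' : c' ∈ M by mem_tac.
case: (upair_ex hcM hcM') => A [hA hAx].
have hAD : incl A D0 by move=> a /hAx [] ->.
apply: representable_ext (hsup hA hAD) => p hp; split=> h q hq hqp.
  case: (h q hq hqp) => r [hr [hrq [a [/hAx [->|->] har]]]];
    exists r; do 2!split=> //; [left|right].
    by apply/hZ.
  by apply/hZ'.
case: (h q hq hqp) => r [hr [hrq [hz|hz]]]; exists r; do 2!split=> //.
  by exists c; rewrite hAx hZ; auto.
by exists c'; rewrite hAx hZ'; auto.
Qed.

Let rep_false : representable (fun _ => False).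
Proof.
case: model_inhabited => d hd.
have hdef : mdefinable1 (fun x => x <> x) by def_tac.
case: (separation hdef hd) => z [hz hzx].
have hzD : incl z D0 by move=> x /hzx [_ []].
apply: representable_ext (hsup hz hzD) => p hp; split=> // h.
by case: (h p hp (refl hp)) => r [_ [_ [a [/hzx [_ []]]]]].
Qed.

Let rep_canonical c : c ∈ D0 -> representable (rel F c).
Proof. by exists c. Qed.

(** De Morgan; regularity ([hreg]) removes the double complements. *)
Let rep_meet c c' : c ∈ D0 -> c' ∈ D0 ->
  representable (fun p => rel F c p /\ rel F c' p).
Proof.
move=> hc hc'; apply: representable_ext
  (rep_compl (rep_join (rep_compl (rep_canonical hc)) (rep_compl (rep_canonical
    hc')))).
move=> p hp; split=> [h|[h h'] q hq hqp hd].
  split; apply: hreg => // q hq hqp; apply: NNPP => hn.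
    apply: (h q hq hqp); apply: dense_below_here => // r hr hrq; left=> s hs hsr hcs.
    by apply: hn; exists s; split=> //; split=> //; apply: trans hsr hrq.
  apply: (h q hq hqp); apply: dense_below_here => // r hr hrq; right=> s hs hsr hcs.
  by apply: hn; exists s; split=> //; split=> //; apply: trans hsr hrq.
case: (hd q hq (refl hq)) => r [hr [hrq hrc]].
have hrp := trans hr hq hp hrq hqp.
case: hrc => /(_ r hr (refl hr)); apply.
  exact: hdown hc hp hr hrp h.
exact: hdown hc' hp hr hrp h'.
Qed.

Let rep_true : representable (fun _ => True).
Proof.
by apply: representable_ext (rep_compl rep_false) => p hp; split=> // _ q _ _ [].
Qed.

(** Canonical codes are equal when they code the same class ([eqD]), and [ba_le] is inclusion of
    coded classes ([leE]), so the laws become statements about conditions. Antisymmetry of the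
    forcing makes the map sending [p] to the code of its cone injective. The second conclusion
    records that every coded class occurs as a cone. *)
Lemma build_completion : exists B e,
  boolean_completion M C P R B e /\
  forall c, c ∈ D0 -> exists b, b ∈ dom B /\
    forall p, p ∈ P -> (ba_le B (e p) b <-> rel F c p).
Proof.
case: (comprehension canonical_def) => Dm [hDm hDmx].
have hD c : c ∈ Dm <-> canonical c.
  rewrite hDmx; split=> [[]//|h]; split=> //.
  by have hc := canonical_D0 h; mem_tac.
have hDD c : c ∈ Dm -> c ∈ D0 by case/hD.
have repD c (h : c ∈ Dm) := rep_canonical (hDD c h).
pose meetF x y p := rel F x p /\ rel F y p.
pose joinF x y := dense_below (fun p => rel F x p \/ rel F y p).
pose complF x p := forall q, q ∈ P -> rel R q p -> ~ rel F x q.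
pose coneF p q := rel R q p.
pose B := BaData Dm (fun x y => code (meetF x y)) (fun x y => code (joinF x y))
  (fun x => code (complF x)) (code (fun _ => False)) (code (fun _ => True)).
pose e p := code (coneF p).
have codeD Z : representable Z -> code Z ∈ Dm by case/codeP => /hD.
have codeE Z p : representable Z -> p ∈ P -> rel F (code Z) p <-> Z p.
  by case/codeP => _ h; apply: h.
have eqD x y : x ∈ Dm -> y ∈ Dm ->
    (forall p, p ∈ P -> (rel F x p <-> rel F y p)) -> x = y.
  by move=> /hD hx /hD hy; apply: canonical_eq.
have rep_m x y : x ∈ Dm -> y ∈ Dm -> representable (meetF x y).
  by move=> /hDD hx /hDD hy; apply: rep_meet.
have rep_j x y : x ∈ Dm -> y ∈ Dm -> representable (joinF x y).
  by move=> /repD hx /repD hy; apply: rep_join.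
have rep_c x : x ∈ Dm -> representable (complF x).
  by move=> /repD; apply: rep_compl.
have Dd x p q : x ∈ Dm -> p ∈ P -> q ∈ P -> rel R q p -> rel F x p -> rel F x q.
  by move=> /hDD; apply: hdown.
have Dr x p : x ∈ Dm -> p ∈ P -> dense_below (rel F x) p -> rel F x p.
  by move=> /hDD; apply: hreg.
have mE x y p : x ∈ Dm -> y ∈ Dm -> p ∈ P ->
    rel F (code (meetF x y)) p <-> rel F x p /\ rel F y p.
  by move=> hx hy hp; apply: codeE => //; apply: rep_m.
have jE x y p : x ∈ Dm -> y ∈ Dm -> p ∈ P ->
    rel F (code (joinF x y)) p <-> joinF x y p.
  by move=> hx hy hp; apply: codeE => //; apply: rep_j.
have cE x p : x ∈ Dm -> p ∈ P -> rel F (code (complF x)) p <-> complF x p.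
  by move=> hx hp; apply: codeE => //; apply: rep_c.
have zE p : p ∈ P -> rel F (code (fun _ => False)) p <-> False.
  by move=> hp; apply: codeE.
have oE p : p ∈ P -> rel F (code (fun _ => True)) p <-> True.
  by move=> hp; apply: codeE.
have mD x y : x ∈ Dm -> y ∈ Dm -> code (meetF x y) ∈ Dm.
  by move=> hx hy; apply/codeD/rep_m.
have jD x y : x ∈ Dm -> y ∈ Dm -> code (joinF x y) ∈ Dm.
  by move=> hx hy; apply/codeD/rep_j.
have cD x : x ∈ Dm -> code (complF x) ∈ Dm.
  by move=> hx; apply/codeD/rep_c.
have zD : code (fun _ => False) ∈ Dm by apply: codeD.
have oD : code (fun _ => True) ∈ Dm by apply: codeD.
have jl x y p : x ∈ Dm -> p ∈ P -> rel F x p -> joinF x y p.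
  move=> hx hp h; apply: dense_below_here => // r hr hrp; left.
  exact: Dd hx hp hr hrp h.
have jr x y p : y ∈ Dm -> p ∈ P -> rel F y p -> joinF x y p.
  move=> hx hp h; apply: dense_below_here => // r hr hrp; right.
  exact: Dd hx hp hr hrp h.
(* Elimination rule for joins: since the class of [z] is regular, the density in [joinF] turns into
   a case distinction. *)
have jI x y z p : z ∈ Dm -> p ∈ P -> joinF x y p ->
    (forall q, q ∈ P -> rel R q p -> rel F x q \/ rel F y q -> rel F z q) ->
      rel F z p.
  move=> hz hp hj h; apply: (@Dr) => //; apply: dense_below_bind hj _ =>
    // q hq hqp h'.
  apply: dense_below_here => // r hr hrq; apply: (Dd _ q) => //.
  exact: h.
have BA : boolean_algebra B.
{ split=> //=.
  - move=> x y hx hy; apply: eqD; auto; move=> p hp.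
    by rewrite !mE //; tauto.
  - move=> x y hx hy; have hxy := jD x y hx hy; have hyx := jD y x hy hx.
    apply: eqD => // p hp; split=> h.
      move/(jE _ _ _ hx hy hp): h => h; apply: (@jI) h _ => // q hq _ [h|h];
        (apply/jE => //; first [exact: (@jr) | exact: (@jl)]).
    move/(jE _ _ _ hy hx hp): h => h; apply: (@jI) h _ => // q hq _ [h|h];
      (apply/jE => //; first [exact: (@jr) | exact: (@jl)]).
  - move=> x y z hx hy hz; apply: eqD; auto; move=> p hp.
    by rewrite !mE //; auto; tauto.
  - move=> x y z hx hy hz; have hyz := jD y z hy hz; have hxy := jD x y hx hy.
    have hxyz := jD _ z hxy hz; have hxyz' := jD x _ hx hyz.
    apply: eqD => // p hp; split=> h.
      move/(jE _ _ _ hx hyz hp): h => h; apply: (@jI) h _ => // q hq _ [h|h].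
        by apply/jE => //; apply: (@jl) => //; apply/jE => //; apply: (@jl).
      move/(jE _ _ _ hy hz hq): h => h; apply: (@jI) h _ => // r hr _ [h|h].
        by apply/jE => //; apply: (@jl) => //; apply/jE => //; apply: (@jr).
      by apply/jE => //; apply: (@jr).
    move/(jE _ _ _ hxy hz hp): h => h; apply: (@jI) h _ => // q hq _ [h|h].
      move/(jE _ _ _ hx hy hq): h => h; apply: (@jI) h _ => // r hr _ [h|h].
        by apply/jE => //; apply: (@jl).
      by apply/jE => //; apply: (@jr) => //; apply/jE => //; apply: (@jl).
    by apply/jE => //; apply: (@jr) => //; apply/jE => //; apply: (@jr).
  - move=> x y hx hy; apply: eqD; auto; move=> p hp.
    have hj := jD x y hx hy; rewrite mE // jE //.
    by have := jl x y p hx hp; tauto.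
  - move=> x y hx hy; have hm := mD x y hx hy; have hj := jD x _ hx hm.
    apply: eqD => // p hp; split=> h; last by apply/jE => //; apply: (@jl).
    move/(jE _ _ _ hx hm hp): h => h; apply: (@jI) h _ => // q hq _ [//|].
    by rewrite mE //; case.
  - move=> x y z hx hy hz; have hyz := jD y z hy hz.
    have hxy := mD x y hx hy; have hxz := mD x z hx hz.
    have hl := mD x _ hx hyz; have hr := jD _ _ hxy hxz.
    apply: eqD => // p hp; split=> h.
      move/(mE _ _ _ hx hyz hp): h => [h1 h2].
      move/(jE _ _ _ hy hz hp): h2 => h2; apply: (@jI) h2 _ => // q hq hqp h.
      have h1q := Dd x p q hx hp hq hqp h1.
      by apply/jE => //; case: h => h; [apply: (@jl) | apply: (@jr)] => //; apply/mE.
    move/(jE _ _ _ hxy hxz hp): h => h; apply: (@jI) h _ =>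
      // q hq _ [] /mE [] // h1 h2.
      by apply/mE => //; split=> //; apply/jE => //; apply: (@jl).
    by apply/mE => //; split=> //; apply/jE => //; apply: (@jr).
  - move=> x hx; have hc := cD x hx; have hm := mD x _ hx hc.
    apply: eqD => // p hp; rewrite mE // cE // zE //; split=> // -[h1 h2].
    exact: (h2 p hp (refl hp)).
  - move=> x hx; have hc := cD x hx; have hj := jD x _ hx hc.
    apply: eqD => // p hp; rewrite jE // oE //; split=> // _ q hq _.
    case: (classic (complF x q)) => [h|h].
      by exists q; split=> //; split; [apply: refl | right; apply/cE].
    apply: NNPP => hn; apply: h => r hr hrq h; apply: hn.
    by exists r; do 2!split=> //; left. }
have leE x y : x ∈ Dm -> y ∈ Dm ->
    (ba_le B x y <-> forall p, p ∈ P -> rel F x p -> rel F y p).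
  move=> hx hy; rewrite /ba_le /=; split=> [<- p hp|h]; first by case/mE.
  have hm := mD x y hx hy; apply: eqD => // p hp; rewrite mE //.
  by have := h p hp; tauto.
have eD p : p ∈ P -> e p ∈ Dm by move=> hp; apply/codeD/hcone.
have eE p q : p ∈ P -> q ∈ P -> rel F (e p) q <-> rel R q p.
  by move=> hp hq; apply: codeE => //; apply: hcone.
have eB p b : p ∈ P -> b ∈ Dm -> (ba_le B (e p) b <-> rel F b p).
  move=> hp hb; have he := eD p hp; rewrite leE //; split=> [h|h q hq].
    by apply: h => //; apply/eE => //; apply: refl.
  by move/(eE _ _ hp hq) => hqp; apply: Dd hp hq hqp h.
(* [code] is a choice made outside the model. Its graph is nevertheless a class, being defined by
   the property that singles out the code among the elements of [Dm]. *)
have graph1_ex X (Z : V -> V -> Prop) : X ∈ C ->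
    (forall x, x ∈ X -> representable (Z x)) ->
    mdefinable1 (fun t => exists x, x ∈ X /\ exists b, b ∈ Dm /\ is_opair t x b /\
      forall p, p ∈ P -> (rel F b p <-> Z x p)) ->
    exists Y, Y ∈ C /\ graph1 X (fun x => code (Z x)) Y.
  move=> hX hrep /comprehension [Y [hY hYt]]; exists Y; split=> // t.
  rewrite hYt; split.
    case=> _ [x [hx [b [hb [ht hbZ]]]]]; exists x; split=> //.
    have hxr := hrep x hx; have hc := codeD _ hxr.
    by have <- // : b = code (Z x); apply: eqD => // p hp; rewrite hbZ // codeE.
  case=> x [hx ht]; have hxr := hrep x hx; have hc := codeD _ hxr.
  have hxM : x ∈ M by mem_tac.
  have hcM : code (Z x) ∈ M by mem_tac.
  case: (opair_ex hxM hcM) => t' [ht' htx].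
  rewrite (opair_unique ht htx); split=> //.
  by exists x; split=> //; exists (code (Z x)); split=> //; split=> // p hp;
    apply: (codeE (Z x)).
exists B, e; split; last first.
  move=> c hc; have hr := rep_canonical hc; exists (code (rel F c)).
  split=> [|p hp]; first exact: codeD.
  have hcD := codeD _ hr.
  by rewrite eB // (codeE (rel F c)).
split=> //.
- move=> A hA hAD; have hAD0 : incl A D0 by move=> a /hAD /hDD.
  have hrep := hsup hA hAD0; exists (code (dense_below (fun r =>
    exists a, a ∈ A /\ rel F a r))).
  have hs := codeD _ hrep; split=> //; split=> [a ha|y hy hay].
    have haD := hAD a ha; apply/leE => // p hp hap; apply/codeE => //.
    apply: dense_below_here => // r hr hrp; exists a; split=> //.
    exact: Dd haD hp hr hrp hap.
  apply/leE => // p hp /(codeE _ _ hrep hp) h; apply: (@Dr) => // q hq hqp.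
  case: (h q hq hqp) => r [hr [hrq [a [ha har]]]]; exists r; do 2!split=> //.
  by move: (hay a ha) => /leE; apply=> //; apply: hAD.
- split=> //.
  have graph2_ex (Z : V -> V -> V -> Prop) :
      (forall x y, x ∈ Dm -> y ∈ Dm -> representable (Z x y)) ->
      mdefinable1 (fun t => exists x, x ∈ Dm /\ exists y, y ∈ Dm /\
        exists u, u ∈ M /\ is_opair u x y /\
        exists b, b ∈ Dm /\ is_opair t u b /\
        forall p, p ∈ P -> (rel F b p <-> Z x y p)) ->
      exists X, X ∈ C /\ graph2 Dm (fun x y => code (Z x y)) X.
    move=> hrep /comprehension [X [hX hXt]]; exists X; split=> // t.
    rewrite hXt; split.
      case=> _ [x [hx [y [hy [u [_ [hu [b [hb [ht hbZ]]]]]]]]]].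
      exists x, y, u; do 3!split=> //.
      have hxy := hrep x y hx hy; have hc := codeD _ hxy.
      by have <- // : b = code (Z x y); apply: eqD => // p hp; rewrite hbZ // codeE.
    case=> x [y [u [hx [hy [hu ht]]]]].
    have hxy := hrep x y hx hy; have hc := codeD _ hxy.
    have hxM : x ∈ M by mem_tac.
    have hyM : y ∈ M by mem_tac.
    have hcM : code (Z x y) ∈ M by mem_tac.
    case: (opair_ex hxM hyM) => u' [hu' huxy].
    have e' := opair_unique hu huxy; subst u.
    case: (opair_ex hu' hcM) => t' [ht' htu].
    rewrite (opair_unique ht htu); split=> //.
    exists x; split=> //; exists y; split=> //; exists u'; do 2!split=> //.
    exists (code (Z x y)); split=> //; split=> // p hp; exact: (codeE (Z x y)).
  split; first by apply: (graph2_ex meetF) => //; rewrite /meetF; def_tac.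
  split; first by apply: (graph2_ex joinF) => //; rewrite /joinF /dense_below;
    def_tac.
  by apply: graph1_ex => //; rewrite /complF; def_tac.
- split=> //.
  + move=> p hp h; apply/(zE p hp); rewrite -[code _]h; apply/eE => //.
    exact: refl.
  + move=> p q hp hq h; apply: hanti => //.
      by apply/eE => //; rewrite -h; apply/eE => //; apply: refl.
    by apply/eE => //; rewrite h; apply/eE => //; apply: refl.
  + move=> p q hp hq; have heq := eD q hq; rewrite eB //.
    exact: iff_sym (eE _ _ hq hp).
  + move=> b hb hbz; case: (classic (exists p, p ∈ P /\ rel F b p)) => [|hn].
      by case=> p [hp hbp]; exists p; split=> //; apply/eB.
    case: hbz; apply: eqD => // p hp; rewrite zE //.
    by split=> // h; case: hn; exists p.
- by apply: graph1_ex => //; rewrite /coneF; def_tac.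
Qed.

End Build.

(** * Cones in a Boolean completion *)

Section Cones.
Context (B : ba_data) (e : V -> V) (hB : boolean_algebra B)
  (he : dense_embedding P R B e).

Notation "x ⊑ y" := (ba_le B x y) (at level 70).
Notation dB := (dom B).

Let mD := ba_meet_dom hB.
Let jD := ba_join_dom hB.
Let cD := ba_compl_dom hB.

Let meet_idem x : x ∈ dB -> meet B x x = x.
Proof.
move=> hx; have := ba_meetK hB hx (mD hx hx); by rewrite (ba_joinK hB hx hx).
Qed.

Lemma ba_le_trans x y z : x ∈ dB -> y ∈ dB -> z ∈ dB -> x ⊑ y -> y ⊑ z -> x ⊑ z.
Proof.
rewrite /ba_le => hx hy hz hxy hyz.
by rewrite -[in LHS]hxy -(ba_meetA hB) // hyz.
Qed.

Lemma ba_le_antisym x y : x ∈ dB -> y ∈ dB -> x ⊑ y -> y ⊑ x -> x = y.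
Proof. by rewrite /ba_le => hx hy h1 h2; rewrite -h1 (ba_meetC hB). Qed.

Let le_meetl x y : x ∈ dB -> y ∈ dB -> meet B x y ⊑ x.
Proof.
move=> hx hy; rewrite /ba_le (ba_meetC hB) ?(ba_meetA hB) ?meet_idem //; auto.
Qed.

Let le_meetr x y : x ∈ dB -> y ∈ dB -> meet B x y ⊑ y.
Proof. by move=> hx hy; rewrite /ba_le -(ba_meetA hB) ?meet_idem. Qed.

Let le_meet x y z : x ∈ dB -> y ∈ dB -> z ∈ dB ->
  z ⊑ x -> z ⊑ y -> z ⊑ meet B x y.
Proof. by rewrite /ba_le => hx hy hz h1 h2; rewrite (ba_meetA hB) // h1. Qed.

Let zD := ba_zero_dom hB.

Let join0 x : x ∈ dB -> join B (zero B) x = x.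
Proof.
move=> hx; rewrite (ba_joinC hB) // -(ba_meet_compl hB hx).
by rewrite (ba_joinK hB) //; apply: cD.
Qed.

Let meet_split x y : x ∈ dB -> y ∈ dB ->
  x = join B (meet B x y) (meet B x (compl B y)).
Proof.
move=> hx hy; have hc := cD hy.
rewrite -(ba_meet_join hB) // (ba_join_compl hB) // -(ba_join_compl hB hx).
by rewrite (ba_meetK hB) //; apply: cD.
Qed.

Let le_compl x y : x ∈ dB -> y ∈ dB -> meet B x y = zero B -> x ⊑ compl B y.
Proof.
move=> hx hy h; rewrite /ba_le {2}(meet_split hx hy) h join0 //.
exact: mD hx (cD hy).
Qed.

Let le_of_compl x y : x ∈ dB -> y ∈ dB -> meet B x (compl B y) = zero B -> x ⊑ y.
Proof.
move=> hx hy h; rewrite /ba_le {2}(meet_split hx hy) h (ba_joinC hB) ?join0 //; auto.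
Qed.

Let le_both x y : x ∈ dB -> y ∈ dB -> x ⊑ y -> x ⊑ compl B y -> x = zero B.
Proof.
move=> hx hy h1 h2; have := le_meet hy (cD hy) hx h1 h2.
rewrite (ba_meet_compl hB) // => h; rewrite /ba_le in h; rewrite -h.
by rewrite -(ba_meet_compl hB hx) (ba_meetA hB) ?meet_idem //; auto.
Qed.

Let eD p : p ∈ P -> e p ∈ dB.
Proof. exact: (de_maps he). Qed.

Let dense b : b ∈ dB -> b <> zero B -> exists p, p ∈ P /\ e p ⊑ b.
Proof. exact: (de_dense he). Qed.

Let eR p q : p ∈ P -> q ∈ P -> (rel R p q <-> e p ⊑ e q).
Proof. exact: (de_order he). Qed.

Lemma cone_down b p q : b ∈ dB -> p ∈ P -> q ∈ P -> rel R q p ->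
  e p ⊑ b -> e q ⊑ b.
Proof. by move=> hb hp hq /(eR hq hp); apply: ba_le_trans; auto. Qed.

(** This is how density of the embedding enters: elements with a nonzero meet have a condition below
    both. *)
Let meets x y : x ∈ dB -> y ∈ dB -> meet B x y <> zero B ->
  exists p, p ∈ P /\ e p ⊑ x /\ e p ⊑ y.
Proof.
move=> hx hy /(dense (mD hx hy)) [p [hp h]]; exists p; split=> //.
by split; apply: ba_le_trans (eD hp) (mD hx hy) _ h _; auto.
Qed.

Lemma cone_compl b p : b ∈ dB -> p ∈ P ->
  (e p ⊑ compl B b <-> forall q, q ∈ P -> rel R q p -> ~ e q ⊑ b).
Proof.
move=> hb hp; split=> [h q hq hqp hqb|h].
  have hqc := cone_down (cD hb) hp hq hqp h.
  exact: (de_nonzero he hq (le_both (eD hq) hb hqb hqc)).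
apply: le_compl; auto; apply: NNPP => /(meets (eD hp) hb) [q [hq [h1 h2]]].
by apply: (h q hq) => //; apply/eR.
Qed.

Lemma cone_regular b p : b ∈ dB -> p ∈ P ->
  dense_below (fun q => e q ⊑ b) p -> e p ⊑ b.
Proof.
move=> hb hp h; apply: le_of_compl; auto; apply: NNPP.
move=> /(meets (eD hp) (cD hb)) [q [hq [h1 h2]]].
case: (h q hq) => [|r [hr [hrq hrb]]]; first exact/eR.
by move/(cone_compl hb hq): h2 => /(_ r hr hrq).
Qed.

Lemma cone_incl b b' : b ∈ dB -> b' ∈ dB ->
  (forall p, p ∈ P -> e p ⊑ b -> e p ⊑ b') -> b ⊑ b'.
Proof.
move=> hb hb' h; apply: le_of_compl => //; apply: NNPP.
move=> /(meets hb (cD hb')) [q [hq [h1 h2]]].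
exact: (de_nonzero he hq (le_both (eD hq) hb' (h q hq h1) h2)).
Qed.

Lemma cone_inj b b' : b ∈ dB -> b' ∈ dB ->
  (forall p, p ∈ P -> (e p ⊑ b <-> e p ⊑ b')) -> b = b'.
Proof.
by move=> hb hb' h; apply: ba_le_antisym => //; apply: cone_incl => // p hp;
  rewrite h.
Qed.

Lemma cone_meet x y p : x ∈ dB -> y ∈ dB -> p ∈ P ->
  (e p ⊑ meet B x y <-> e p ⊑ x /\ e p ⊑ y).
Proof.
move=> hx hy hp; split=> [h|[h1 h2]]; last by apply: le_meet; auto.
by split; apply: ba_le_trans (eD hp) (mD hx hy) _ h _; auto.
Qed.

(** If no extension of [q] were below an element of [A], the complement of [e q] would be an upper
    bound of [A], hence above [b] and above [e q] itself. *)
Lemma cone_sup A b p : incl A dB -> is_sup B A b -> p ∈ P ->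
  (e p ⊑ b <-> dense_below (fun q => exists a, a ∈ A /\ e q ⊑ a) p).
Proof.
move=> hA [hb [hub hlub]] hp; split=> [h q hq hqp|h]; last first.
  apply: cone_regular => //; apply: dense_below_bind h _ => // q hq _ [a [ha hqa]].
  apply: dense_below_here => // r hr hrq.
  apply: (cone_down hb hq hr hrq).
  by apply: ba_le_trans (eD hq) (hA _ ha) hb hqa _; apply: hub.
apply: NNPP => hn.
have hc := cD (eD hq).
have hbc : b ⊑ compl B (e q).
  apply: hlub => // a ha; have haD := hA _ ha.
  apply: le_compl; auto; apply: NNPP => /(meets haD (eD hq)) [r [hr [h1 h2]]].
  by apply: hn; exists r; split=> //; split; [apply/eR | exists a].
have hqb := cone_down hb hp hq hqp h.
have hqc := ba_le_trans (eD hq) hb hc hqb hbc.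
move/(cone_compl (eD hq) hq): hqc => /(_ q hq (refl hq)); apply.
exact: meet_idem (eD hq).
Qed.

Lemma cone_join x y p : x ∈ dB -> y ∈ dB -> p ∈ P ->
  (e p ⊑ join B x y <-> dense_below (fun q => e q ⊑ x \/ e q ⊑ y) p).
Proof.
move=> hx hy hp; have hj := jD hx hy.
have hxj : x ⊑ join B x y by apply: (ba_meetK hB).
have hyj : y ⊑ join B x y by rewrite (ba_joinC hB) //; apply: (ba_meetK hB).
split=> [h q hq hqp|h].
  have hqj := cone_down hj hp hq hqp h; apply: NNPP => hn.
  have no z : z ∈ dB -> (z = x \/ z = y) -> meet B (e q) z = zero B.
    move=> hz hzxy; apply: NNPP => /(meets (eD hq) hz) [r [hr [h1 h2]]].
    apply: hn; exists r; split=> //; split; first exact/eR.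
    by case: hzxy => <-; auto.
  have heq := eD hq.
  apply: (de_nonzero he hq); rewrite -hqj (ba_meet_join hB) //.
  by rewrite !no ?join0; auto.
apply: cone_regular => //; apply: dense_below_bind h _ => // q hq _ h.
apply: dense_below_here => // r hr hrq; apply: (cone_down hj hq hr hrq).
by case: h => h; apply: ba_le_trans (eD hq) _ hj h _.
Qed.

Lemma cone_zero p : p ∈ P -> ~ e p ⊑ zero B.
Proof.
move=> hp h; have hep := eD hp; apply: (de_nonzero he hp).
apply: ba_le_antisym => //.
by rewrite -(ba_meet_compl hB hep); apply: le_meetl => //; apply: cD.
Qed.

Lemma cone_one p : p ∈ P -> e p ⊑ one B.
Proof.
move=> hp; rewrite -(ba_join_compl hB (eD hp)).
exact: (ba_meetK hB (eD hp) (cD (eD hp))).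
Qed.

End Cones.

(** * Completions as classes, and isomorphisms in terms of cones *)

Lemma rel_graph1 X (g : V -> V) K x y : K ∈ C -> incl X M -> graph1 X g K ->
  x ∈ X -> g x ∈ M -> (rel K x y <-> y = g x).
Proof.
move=> hK hX hg hx hgx; split=> [[t [ht /hg [x' [_ ht']]]]|->].
  by case: (opair_inj ht ht') => -> ->.
case: (opair_ex (hX _ hx) hgx) => t [_ ht]; exists t; split=> //.
by apply/hg; exists x.
Qed.

Lemma embedding_class B e : boolean_completion M C P R B e ->
  exists E, E ∈ C /\ forall p y, p ∈ P -> (rel E p y <-> y = e p).
Proof.
move=> hb; case: (bc_embedding_class hb) => E [hE hEg]; exists E; split=> // p y hp.
have hdC : dom B ∈ C by case: (bc_classes hb).
have hep : e p ∈ dom B by apply: (de_maps (bc_embedding hb)).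
apply: (rel_graph1 _ hE _ hEg hp); last by mem_tac.
by move=> x hx; mem_tac.
Qed.

(** [ba_le] is an equation for a function outside the model; definability arguments need it as a
    class relation. With [u] the pair of [q] and [b], [rel G2 u q] says that the meet of [q] and [b]
    is [q]. *)
Lemma cone_class B e : boolean_completion M C P R B e ->
  exists L, L ∈ C /\ forall p b, p ∈ P -> b ∈ dom B ->
    (rel L p b <-> ba_le B (e p) b).
Proof.
move=> hb; case: (embedding_class hb) => E [hE hEp].
case: (bc_classes hb) => hdC [[G2 [hG2 hG2g]] _].
pose dB := dom B; have hdC' : dB ∈ C by [].
have : mdefinable2 (fun p b => exists q, q ∈ M /\ rel E p q /\
    exists u, u ∈ M /\ is_opair u q b /\ rel G2 u q) by def_tac.
case/comprehension2 => L [hL hLx]; exists L; split=> // p b hp hbB.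
have hep : e p ∈ dom B by apply: (de_maps (bc_embedding hb)).
have hepM : e p ∈ M by mem_tac.
have hpM : p ∈ M by mem_tac.
have hbM : b ∈ M by mem_tac.
rewrite hLx /ba_le; split.
  case=> _ [_ [q [_ [/(hEp _ _ hp) -> [u [_ [hu [t [ht /hG2g htg]]]]]]]]].
  case: htg => x [y [u' [hx [hy [hu' ht']]]]].
  case: (opair_inj ht ht') => e1 e2; subst u'.
  by case: (opair_inj hu hu') => e3 e4; subst x y.
move=> h; do 2!split=> //; exists (e p); split=> //; split; first exact/hEp.
case: (opair_ex hepM hbM) => u [hu hub]; exists u; do 2!split=> //.
case: (opair_ex hu hepM) => t [ht htu]; exists t; split=> //.
by apply/hG2g; exists (e p), b, u; rewrite h.
Qed.

(** Matching elements with equal cones is a bijection because cones determine elements, and it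
    respects the operations because the cone of a result depends only on the cones of its arguments.
    Its graph is definable from the two cone relations, hence a set of [V]. *)
Lemma isomorphic_of_cones B0 e0 B1 e1 :
  boolean_completion M C P R B0 e0 -> boolean_completion M C P R B1 e1 ->
  (forall b, b ∈ dom B0 -> exists c, c ∈ dom B1 /\
    forall p, p ∈ P -> (ba_le B0 (e0 p) b <-> ba_le B1 (e1 p) c)) ->
  (forall c, c ∈ dom B1 -> exists b, b ∈ dom B0 /\
    forall p, p ∈ P -> (ba_le B0 (e0 p) b <-> ba_le B1 (e1 p) c)) ->
  isomorphic_over P B0 e0 B1 e1.
Proof.
move=> hb0 hb1 h01 h10.
have hB0 := bc_algebra hb0; have hB1 := bc_algebra hb1.
have he0 := bc_embedding hb0; have he1 := bc_embedding hb1.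
pose h b := epsilon (inhabits M) (fun c => c ∈ dom B1 /\
  forall p, p ∈ P -> (ba_le B0 (e0 p) b <-> ba_le B1 (e1 p) c)).
have hP' b : b ∈ dom B0 -> h b ∈ dom B1 /\
    forall p, p ∈ P -> (ba_le B0 (e0 p) b <-> ba_le B1 (e1 p) (h b)).
  by move=> /h01; apply: epsilon_spec.
have hD b : b ∈ dom B0 -> h b ∈ dom B1 by case/hP'.
have hE b p : b ∈ dom B0 -> p ∈ P ->
    (ba_le B1 (e1 p) (h b) <-> ba_le B0 (e0 p) b).
  by move=> /hP' [_ hh] hp; rewrite hh.
have inj1 := cone_inj hB1 he1; have inj0 := cone_inj hB0 he0.
have [H [hHC hHg]] : exists H, H ∈ C /\ graph1 (dom B0) h H.
  case: (cone_class hb0) => L0 [hL0 hL0x]; case: (cone_class hb1) => L1 [hL1 hL1x].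
  case: (bc_classes hb0) => hd0 _; case: (bc_classes hb1) => hd1 _.
  have : mdefinable1 (fun t => exists b, b ∈ dom B0 /\ exists c, c ∈ dom B1 /\
      is_opair t b c /\ forall p, p ∈ P -> (rel L0 p b <-> rel L1 p c)) by def_tac.
  case/comprehension => H [hH hHt]; exists H; split=> // t; rewrite hHt; split.
    case=> _ [b [hb [c [hc [ht hbc]]]]]; exists b; split=> //.
    have <- // : c = h b; apply: (inj1) => //; first exact: hD.
    by move=> p hp; rewrite hE // -hL1x // -hL0x // hbc.
  case=> b [hb ht]; have hc := hD b hb.
  have hbM : b ∈ M by mem_tac.
  have hcM : h b ∈ M by mem_tac.
  case: (opair_ex hbM hcM) => t' [ht' htt'].
  rewrite (opair_unique ht htt'); split=> //; exists b; split=> //.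
  by exists (h b); do 2!split=> //; move=> *; rewrite hL0x // hL1x // hE.
exists h, H; split=> //; split; last first.
  move=> p hp; have h0p := de_maps he0 hp; have h1p := de_maps he1 hp.
  apply: (inj1) => //; first exact: hD.
  by move=> q hq; rewrite hE // -(de_order he0) // (de_order he1).
split.
- split; first exact: hD.
  split=> [x y hx hy hxy|c hc].
    by apply: (inj0) => // p hp; rewrite -!hE // hxy.
  case: (h10 c hc) => b [hb hbc]; exists b; split=> //.
  by apply: (inj1) => // [|p hp]; [exact: hD | rewrite hE // hbc].
- move=> x y hx hy; have hm := ba_meet_dom hB0 hx hy.
  have hhx := hD x hx; have hhy := hD y hy; have hhm := hD _ hm.
  have hmh := ba_meet_dom hB1 hhx hhy; apply: (inj1) => // p hp.
  by rewrite hE // (cone_meet hB0 he0) // (cone_meet hB1 he1) // !hE.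
- move=> x y hx hy; have hm := ba_join_dom hB0 hx hy.
  have hhx := hD x hx; have hhy := hD y hy; have hhm := hD _ hm.
  have hmh := ba_join_dom hB1 hhx hhy; apply: (inj1) => // p hp.
  rewrite hE // (cone_join hB0 he0) // (cone_join hB1 he1) //.
  by split=> hd q hq hqp; case: (hd q hq hqp) => r [hr [hrq hrd]];
    exists r; split=> //; split=> //; move: hrd; rewrite !hE.
- move=> x hx; have hm := ba_compl_dom hB0 hx.
  have hhx := hD x hx; have hhm := hD _ hm.
  have hmh := ba_compl_dom hB1 hhx; apply: (inj1) => // p hp.
  rewrite hE // (cone_compl hB0 he0) // (cone_compl hB1 he1) //.
  by split=> hd q hq hqp; move: (hd q hq hqp); rewrite hE.
- have h0 := ba_zero_dom hB0; have h1 := ba_zero_dom hB1.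
  apply: (inj1) => // [|p hp]; first exact: hD.
  rewrite hE //; have := cone_zero hB0 he0 hp; have := cone_zero hB1 he1 hp; tauto.
- have h0 := ba_one_dom hB0; have h1 := ba_one_dom hB1.
  apply: (inj1) => // [|p hp]; first exact: hD.
  rewrite hE //; have := cone_one hB0 he0 hp; have := cone_one hB1 he1 hp; tauto.
Qed.

(** [e0 p] being below [b] is an equation between meets; [h] preserves it and, being injective,
    reflects it. *)
Lemma cones_of_isomorphic B0 e0 B1 e1 c :
  boolean_completion M C P R B0 e0 -> isomorphic_over P B0 e0 B1 e1 ->
  c ∈ dom B1 -> exists b, b ∈ dom B0 /\
    forall p, p ∈ P -> (ba_le B0 (e0 p) b <-> ba_le B1 (e1 p) c).
Proof.
move=> hb0 [h [H [_ [hiso hfix]]]] hc.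
case: (iso_bij hiso) => _ [hinj hsurj]; case: (hsurj c hc) => b [hb <-].
exists b; split=> // p hp; have hep := de_maps (bc_embedding hb0) hp.
have hm := ba_meet_dom (bc_algebra hb0) hep hb.
rewrite /ba_le -hfix // -(iso_meet hiso) //; split=> [->//|].
exact: hinj.
Qed.

Context (hsep : separative P R).

(** * The [Ord]-chain condition gives a unique completion *)

(* A set [A] of conditions codes the regular open class [A^⊥⊥]. *)
Lemma completion_of_Ord_cc : Ord_cc M C P R -> has_unique_completion M C P R.
Proof.
move=> hcc.
have : mdefinable1 (fun A => forall a, a ∈ A -> a ∈ P) by def_tac.
case/comprehension => D0 [hD0 hD0x].
have : mdefinable2 (fun A p => p ∈ P /\ forall q, q ∈ P -> rel R q p ->
    exists r, r ∈ P /\ rel R r q /\ exists a, a ∈ A /\ rel R r a) by def_tac.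
case/comprehension2 => F [hF hFx].
have hFE A p : A ∈ D0 -> p ∈ P ->
    (rel F A p <-> dense_below (fun r => exists a, a ∈ A /\ rel R r a) p).
  move=> hA hp; rewrite hFx; split=> [[_ [_ []]] //|h].
  have hAM : A ∈ M by mem_tac.
  have hpM : p ∈ M by mem_tac.
  by do 3!split=> //.
have hdown c p q : c ∈ D0 -> p ∈ P -> q ∈ P -> rel R q p -> rel F c p -> rel F c q.
  move=> hc hp hq hqp; rewrite !hFE // => h r hr hrq; apply: h => //.
  exact: trans hrq hqp.
have hreg c p : c ∈ D0 -> p ∈ P -> dense_below (rel F c) p -> rel F c p.
  move=> hc hp h; apply/hFE => //; apply: dense_below_bind h _ => // q hq _.
  by rewrite hFE.
have hmem A a p : A ∈ D0 -> a ∈ A -> p ∈ P -> rel R p a -> rel F A p.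
  move=> hA ha hp hpa; apply/hFE => //; apply: dense_below_here => // r hr hrp.
  by exists a; split=> //; apply: trans hrp hpa => //; case/hD0x: hA => _; apply.
(* This is where the [Ord]-cc acts: a set predense in [U] codes the regular open class [U]. *)
have hrep U : U ∈ C -> incl U P ->
    (forall p q, p ∈ U -> q ∈ P -> rel R q p -> q ∈ U) ->
    (forall p, p ∈ P -> dense_below (fun q => q ∈ U) p -> p ∈ U) ->
    exists A, A ∈ D0 /\ forall p, p ∈ P -> (rel F A p <-> p ∈ U).
  move=> hU hUP hUd hUr; case: (predense_set hcc hU hUP hUd) => A [hAM [hAU hA]].
  have hAD : A ∈ D0 by apply/hD0x; split=> // a /hAU /hUP.
  exists A; split=> // p hp; rewrite hFE //; split=> [h|hpU q hq hqp].
    apply: hUr => // q hq hqp; case: (h q hq hqp) => r [hr [hrq [a [ha hra]]]].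
    by exists r; do 2!split=> //; apply: hUd hra => //; apply: hAU.
  have hqU := hUd p q hpU hq hqp; case: (hA q hqU) => a [ha /NNPP [r [hr [hra hrq]]]].
  by exists r; do 2!split=> //; exists a.
case: (build_completion hD0 hF hdown hreg).
- move=> p hp; have hpM : p ∈ M by mem_tac.
  case: (singleton_ex hpM) => A [hA hAx].
  have hAD : A ∈ D0 by apply/hD0x; split=> // a /hAx ->.
  exists A; split=> // q hq; split=> [/(hFE _ _ hAD hq) h|hqp]; last first.
    by apply: (hmem A p) => //; apply/hAx.
  (* Separativity says that cones are regular, so that the singleton of [p] codes no more than the
     cone of [p]. *)
  apply: NNPP => hn; case: (hsep hq hp hn) => r [hr [hrq hrp]].
  case: (h r hr hrq) => s [hs [hsr [a [/hAx -> hsp]]]].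
  by apply: hrp; exists s.
- move=> c hc.
  have : mdefinable1 (fun p => p ∈ P /\ forall q, q ∈ P -> rel R q p -> ~ rel F c q).
    by have hcM : c ∈ M by [mem_tac]; def_tac.
  case/comprehension => U [hU hUx].
  have hUE p : p ∈ P ->
      (p ∈ U <-> forall q, q ∈ P -> rel R q p -> ~ rel F c q).
    by move=> hp; rewrite hUx; split=> [[_ []] //|h]; split=> //; mem_tac.
  have hUP : incl U P by move=> p /hUx [_ []].
  case: (hrep U hU hUP) => [p q hpU hq hqp|p hp h|A [hA hAE]].
  + have hp := hUP _ hpU; apply/hUE => // r hr hrq; move/hUE: hpU.
    by move=> /(_ hp); apply=> //; apply: trans hrq hqp.
  + apply/hUE => // q hq hqp hcq; case: (h q hq hqp) => r [hr [hrq hrU]].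
    move/hUE: hrU => /(_ hr r hr (refl hr)); apply.
    exact: hdown hc hq hr hrq hcq.
  + by exists A; split=> // p hp; rewrite hAE // hUE.
(* The union of a set of codes is again a set of conditions and codes their supremum. *)
- move=> S hS hSD; case: (set_union hS) => A [hA hAx].
  have hAD : A ∈ D0.
    by apply/hD0x; split=> // a /hAx [c [/hSD /hD0x [_ h] /h]].
  exists A; split=> // p hp; rewrite hFE //; split=> h.
    move=> q hq hqp; case: (h q hq hqp) => r [hr [hrq [a [/hAx [c [hc hac]] hra]]]].
    by exists r; do 2!split=> //; exists c; split=> //; apply: (hmem c a) => //;
      apply: hSD.
  apply: dense_below_bind h _ => // q hq _ [c [hc hcq]].
  move/(hFE _ _ (hSD _ hc) hq): hcq => h r hr hrq.
  case: (h r hr hrq) => s [hs [hsr [a [ha hsa]]]].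
  by exists s; do 2!split=> //; exists a; split=> //; apply/hAx; exists c.
- move=> B0 [e0 [hb0 hcodes]]; exists B0, e0; split=> // B1 e1 hb1.
have hregular B e b : boolean_completion M C P R B e -> b ∈ dom B ->
    exists A, A ∈ D0 /\ forall p, p ∈ P -> (rel F A p <-> ba_le B (e p) b).
{ move=> hb hbB; have hB := bc_algebra hb; have he := bc_embedding hb.
  case: (cone_class hb) => L [hL hLx]; case: (bc_classes hb) => hdC _.
  have hbM : b ∈ M by mem_tac.
  have : mdefinable1 (fun p => p ∈ P /\ rel L p b) by def_tac.
  case/comprehension => U [hU hUx].
  have hUP : incl U P by move=> p /hUx [_ []].
  have hUE p : p ∈ P -> (p ∈ U <-> ba_le B (e p) b).
    move=> hp; rewrite -hLx // hUx; split=> [[_ []] //|h]; split=> //; mem_tac.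
  case: (hrep U hU hUP) => [p q hpU hq hqp|p hp h|A [hA hAE]].
  + have hp := hUP _ hpU; apply/hUE => //; apply: (cone_down hB he hbB hp hq hqp).
    exact/hUE.
  + apply/hUE => //; apply: (cone_regular hB he) => //.
    by apply: dense_below_bind h _ => // q hq _ /(hUE _ hq) h r hr hrq;
      exists r; split=> //; split;
        [exact: refl | exact: (cone_down hB he hbB hq hr hrq)].
  + by exists A; split=> // p hp; rewrite hAE // hUE. }
apply: isomorphic_of_cones => // [b hb|c hc].
  (* The element [b] is generated by a set [A] of conditions. The image of [A] under [e1] is a set
     by replacement, and its supremum in [B1] has the same cone as [b]. In the other direction, [B0]
     contains an element for every code. *)
  case: (hregular B0 e0 b hb0 hb) => A [hA hAE].
  have hB := bc_algebra hb1; have he := bc_embedding hb1.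
  have hAM : A ∈ M by mem_tac.
  have hAP : incl A P by case/hD0x: hA => _ h x; apply: h.
  case: (embedding_class hb1) => E [hE hEx].
  have hdef : mdefinable2 (fun a y => rel E a y) by def_tac.
  case: (replacement hdef hAM) => [a y y' /hAP ha _ _|S [hS hSx]].
    by rewrite !hEx // => -> ->.
  have hSE y : y ∈ S <-> exists a, a ∈ A /\ y = e1 a.
    rewrite hSx; split=> [[_ [a [ha]]]|[a [ha hy]]].
      have haP := hAP _ ha; by rewrite hEx // => hy; exists a.
    have hra : rel E a y by apply/hEx => //; apply: hAP.
    by split; [case: (rel_mem hE hra) | exists a].
  have hSB : incl S (dom B1).
    by move=> y /hSE [a [/hAP ha ->]]; apply: (de_maps he).
  case: (bc_complete hb1 hS hSB) => c hc; exists c; split; first by case: hc.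
  move=> p hp; rewrite -hAE // hFE // (cone_sup hB he hSB hc hp).
  split=> h q hq hqp; case: (h q hq hqp) => r [hr [hrq [a [ha hra]]]];
    exists r; do 2!split=> //.
    exists (e1 a); split; first by apply/hSE; exists a.
    by apply/(de_order he) => //; apply: hAP.
  case/hSE: ha => a' [ha' ea]; subst a; exists a'; split=> //.
  by apply/(de_order he) => //; apply: hAP.
case: (hregular B1 e1 c hb1 hc) => A [hA hAE].
case: (hcodes A hA) => b [hb hbE]; exists b; split=> // p hp.
by rewrite hbE // hAE.
Qed.

(** * Adding a regular open class to a completion *)

(* The new algebra consists of the elements [(b ∧ U) ∨ (c ∧ ¬U)], coded by the pairs
   [(b, c)]; by distributivity their suprema are computed coordinatewise. *)
Lemma completion_with_class B0 e0 U : boolean_completion M C P R B0 e0 ->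
  U ∈ C -> incl U P ->
  (forall p q, p ∈ U -> q ∈ P -> rel R q p -> q ∈ U) ->
  (forall p, p ∈ P -> dense_below (fun q => q ∈ U) p -> p ∈ U) ->
  exists B1 e1, boolean_completion M C P R B1 e1 /\
    exists c, c ∈ dom B1 /\ forall p, p ∈ P -> (ba_le B1 (e1 p) c <-> p ∈ U).
Proof.
move=> hb0 hU hUP hUd hUr.
have hB := bc_algebra hb0; have he := bc_embedding hb0.
case: (cone_class hb0) => L [hL hLx]; case: (bc_classes hb0) => hdC _.
pose U' p := p ∈ P /\ forall q, q ∈ P -> rel R q p -> q ∉ U.
(* Conditions deciding [U] are dense, so below them membership in a regular class can be tested on
   the two halves separately. *)
have hsplit p : p ∈ P -> exists q, q ∈ P /\ rel R q p /\ (q ∈ U \/ U' q).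
  move=> hp; case: (classic (U' p)) => [h|h].
    by exists p; split=> //; split; [exact: refl | right].
  apply: NNPP => hn; apply: h; split=> // q hq hqp hqU; apply: hn.
  by exists q; do 2!split=> //; left.
have hUU' p : p ∈ U -> ~ U' p.
  by move=> hpU [hp h]; apply: h hpU => //; apply: refl.
have hU'd p q : U' p -> q ∈ P -> rel R q p -> U' q.
  move=> [hp h] hq hqp; split=> // r hr hrq; apply: h => //.
  exact: trans hrq hqp.
have : mdefinable1 (fun t => exists b, b ∈ dom B0 /\ exists c, c ∈ dom B0 /\
    is_opair t b c) by def_tac.
case/comprehension => D0 [hD0 hD0x].
have : mdefinable2 (fun t p => exists b, b ∈ dom B0 /\ exists c, c ∈ dom B0 /\
    is_opair t b c /\ p ∈ P /\ forall q, q ∈ P -> rel R q p ->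
    (q ∈ U -> rel L q b) /\
    ((q ∈ P /\ forall r, r ∈ P -> rel R r q -> r ∉ U) -> rel L q c)) by def_tac.
case/comprehension2 => F [hF hFx].
have hFE t b c p : b ∈ dom B0 -> c ∈ dom B0 -> is_opair t b c -> t ∈ M -> p ∈ P ->
    (rel F t p <-> forall q, q ∈ P -> rel R q p ->
      (q ∈ U -> ba_le B0 (e0 q) b) /\ (U' q -> ba_le B0 (e0 q) c)).
  move=> hb hc ht htM hp; rewrite hFx; split.
    case=> _ [_ [b' [hb' [c' [hc' [ht' [_ h]]]]]]] q hq hqp.
    case: (opair_inj ht ht') => eb ec; subst b' c'.
    by case: (h q hq hqp) => h1 h2; split=> hh; apply/hLx => //; auto.
  move=> h; have hpM : p ∈ M by mem_tac.
  do 2!split=> //; exists b; split=> //; exists c; split=> //; split=> //;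
    split=> // q hq hqp.
  by case: (h q hq hqp) => h1 h2; split=> hh; apply/hLx => //; auto.
have hD0E t : t ∈ D0 -> t ∈ M /\ exists b c, b ∈ dom B0 /\ c ∈ dom B0 /\
  is_opair t b c.
  by case/hD0x=> htM [b [hb [c [hc ht]]]]; split=> //; exists b, c.
have hpair b c : b ∈ dom B0 -> c ∈ dom B0 ->
    exists t, t ∈ M /\ t ∈ D0 /\ is_opair t b c.
  move=> hb hc; have hbM : b ∈ M by mem_tac.
  have hcM : c ∈ M by mem_tac.
  case: (opair_ex hbM hcM) => t [htM ht]; exists t; do 2!split=> //.
  by apply/hD0x; split=> //; exists b; split=> //; exists c.
have hdown t p q : t ∈ D0 -> p ∈ P -> q ∈ P -> rel R q p -> rel F t p -> rel F t q.
  case/hD0E => htM [b [c [hb [hc ht]]]] hp hq hqp; rewrite !(hFE _ _ _ _ hb hc ht) //.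
  by move=> h r hr hrq; apply: h => //; apply: trans hrq hqp.
have hreg t p : t ∈ D0 -> p ∈ P -> dense_below (rel F t) p -> rel F t p.
  case/hD0E => htM [b [c [hb [hc ht]]]] hp h; apply/(hFE _ _ _ _ hb hc ht) => //.
  move=> q hq hqp; have hd : dense_below (rel F t) q.
    by move=> r hr hrq; apply: h => //; apply: trans hrq hqp.
  split=> hh; apply: (cone_regular hB he) => // r hr hrq;
    case: (hd r hr hrq) => s [hs [hsr /(hFE _ _ _ _ hb hc ht htM hs) hF']];
    exists s; do 2!split=> //; case: (hF' s hs (refl hs)) => h1 h2.
    by apply: h1; apply: hUd hh _ _ => //; apply: trans hsr hrq.
  by apply: h2; apply: hU'd hh _ _ => //; apply: trans hsr hrq.
have he0 p : p ∈ P -> e0 p ∈ dom B0 by apply: (de_maps he).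
case: (build_completion hD0 hF hdown hreg).
- move=> p hp; case: (hpair _ _ (he0 p hp) (he0 p hp)) => t [htM [htD ht]].
  exists t; split=> // q hq; rewrite (hFE _ _ _ _ (he0 p hp) (he0 p hp) ht) //.
  rewrite (de_order he) //; split=> [h|hqp r hr hrq]; last first.
    by split=> _; apply: (cone_down hB he (he0 p hp) hq hr hrq).
  apply: (cone_regular hB he) => // [|r hr hrq]; first exact: he0.
  case: (hsplit r hr) => s [hs [hsr hsU]]; exists s; do 2!split=> //.
  case: (h s hs (trans hs hr hq hsr hrq)) => h1 h2.
  by case: hsU.
- move=> t /hD0E [htM [b [c [hb [hc ht]]]]].
  have hb' := ba_compl_dom hB hb; have hc' := ba_compl_dom hB hc.
  case: (hpair _ _ hb' hc') => t' [htM' [htD' ht']]; exists t'; split=> // p hp.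
  rewrite (hFE _ _ _ _ hb' hc' ht') //; split=> h q hq hqp.
    move/(hFE _ _ _ _ hb hc ht htM hq) => h'.
    case: (hsplit q hq) => r [hr [hrq hrU]].
    case: (h r hr (trans hr hq hp hrq hqp)) => h1 h2; case: (h' r hr hrq) => h1' h2'.
    case: hrU => hrU.
      by move/(cone_compl hB he hb hr): (h1 hrU) => /(_ r hr (refl hr)); apply; auto.
    by move/(cone_compl hB he hc hr): (h2 hrU) => /(_ r hr (refl hr)); apply; auto.
  split=> hqU; apply/(cone_compl hB he) => // r hr hrq hrb;
    apply: (h r hr (trans hr hq hp hrq hqp)); apply/(hFE _ _ _ _ hb hc ht) => //;
    move=> s hs hsr; split=> hsU.
  + exact: (cone_down hB he hb hr hs hsr).
  + by case: (hUU' s) => //; apply: hUd hqU _ _ => //; apply: trans hsr hrq.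
  + by case: (hUU' s) => //; apply: hU'd hqU _ _ => //; apply: trans hsr hrq.
  + exact: (cone_down hB he hc hr hs hsr).
- move=> S hS hSD.
  (* Replacement makes both projections of [S] sets, so each has a supremum in [B0]; the pair of
     these codes the supremum of [S]. *)
  have hdef1 : mdefinable2 (fun t b => b ∈ dom B0 /\ exists c, c ∈ dom B0 /\
    is_opair t b c).
    by def_tac.
  have hdef2 : mdefinable2 (fun t c => c ∈ dom B0 /\ exists b, b ∈ dom B0 /\
    is_opair t b c).
    by def_tac.
  case: (replacement hdef1 hS) => [t b b' _ _ _|S1 [hS1 hS1x]].
    by case=> _ [c [_ h]] [_ [c' [_ h']]]; case: (opair_inj h h').
  case: (replacement hdef2 hS) => [t b b' _ _ _|S2 [hS2 hS2x]].
    by case=> _ [c [_ h]] [_ [c' [_ h']]]; case: (opair_inj h h').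
  have hS1D : incl S1 (dom B0) by move=> b /hS1x [_ [t [_ []]]].
  have hS2D : incl S2 (dom B0) by move=> b /hS2x [_ [t [_ []]]].
  case: (bc_complete hb0 hS1 hS1D) => b hbs; case: (bc_complete hb0 hS2 hS2D) =>
    c hcs.
  have hb : b ∈ dom B0 by case: hbs.
  have hc : c ∈ dom B0 by case: hcs.
  case: (hpair _ _ hb hc) => t [htM [htD ht]]; exists t; split=> // p hp.
  rewrite (hFE _ _ _ _ hb hc ht) //; split=> h q hq hqp.
    case: (hsplit q hq) => r [hr [hrq hrU]]; have hrp := trans hr hq hp hrq hqp.
    case: (h r hr hrp) => h1 h2; case: hrU => hrU.
      move/(cone_sup hB he hS1D hbs hr): (h1 hrU) => /(_ r hr (refl hr)).
      case=> s [hs [hsr [b' [/hS1x [_ [t' [htS' [hb' [c' [hc' ht']]]]]] hsb]]]].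
      exists s; split=> //; split; first exact: trans hsr hrq.
      exists t'; split=> //; apply/(hFE _ _ _ _ hb' hc' ht') => //; first by mem_tac.
      move=> u hu hus; split=> huU; first exact: (cone_down hB he hb' hs hu hus).
      case: (hUU' u) => //; apply: (hUd r) => //.
      exact: trans hus hsr.
    move/(cone_sup hB he hS2D hcs hr): (h2 hrU) => /(_ r hr (refl hr)).
    case=> s [hs [hsr [c' [/hS2x [_ [t' [htS' [hc' [b' [hb' ht']]]]]] hsc]]]].
    exists s; split=> //; split; first exact: trans hsr hrq.
    exists t'; split=> //; apply/(hFE _ _ _ _ hb' hc' ht') => //; first by mem_tac.
    move=> u hu hus; split=> huU; last exact: (cone_down hB he hc' hs hu hus).
    case: (hUU' u) => //; apply: (hU'd r) => //.
    exact: trans hus hsr.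
  have hq' r : r ∈ P -> rel R r q -> exists s, s ∈ P /\ rel R s r /\
      exists b' c', b' ∈ S1 /\ c' ∈ S2 /\
        (s ∈ U -> ba_le B0 (e0 s) b') /\ (U' s -> ba_le B0 (e0 s) c').
    move=> hr hrq; case: (h r hr (trans hr hq hp hrq hqp)) =>
      s [hs [hsr [t' [htS' hF']]]].
    exists s; do 2!split=> //.
    case/hSD/hD0E: (htS') => htM' [b' [c' [hb' [hc' ht']]]].
    move/(hFE _ _ _ _ hb' hc' ht' htM' hs): hF' => /(_ s hs (refl hs)) hh.
    exists b', c'; split.
      by apply/hS1x; split; [mem_tac|]; exists t'; do 2!split=> //; exists c'.
    split=> //; apply/hS2x; split; first by mem_tac.
    by exists t'; do 2!split=> //; exists b'.
  split=> hqU.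
    apply/(cone_sup hB he hS1D hbs hq) => r hr hrq.
    case: (hq' r hr hrq) => s [hs [hsr [b' [c' [hb' [_ [h1 _]]]]]]].
    exists s; do 2!split=> //; exists b'; split=> //; apply: h1.
    by apply: hUd hqU _ _ => //; apply: trans hsr hrq.
  apply/(cone_sup hB he hS2D hcs hq) => r hr hrq.
  case: (hq' r hr hrq) => s [hs [hsr [b' [c' [_ [hc' [_ h2]]]]]]].
  exists s; do 2!split=> //; exists c'; split=> //; apply: h2.
  by apply: hU'd hqU _ _ => //; apply: trans hsr hrq.
- move=> B1 [e1 [hb1 hcodes]]; exists B1, e1; split=> //.
  have h1 := ba_one_dom hB; have h0 := ba_zero_dom hB.
  (* With [b = 1] and [c = 0] the element [(b ∧ U) ∨ (c ∧ ¬U)] is [U] itself. *)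
  case: (hpair _ _ h1 h0) => t [htM [htD ht]].
  case: (hcodes t htD) => c [hc hcE]; exists c; split=> // p hp.
  rewrite hcE // (hFE _ _ _ _ h1 h0 ht) //; split=> [h|hpU q hq hqp].
    apply: hUr => // q hq hqp; case: (hsplit q hq) => r [hr [hrq hrU]].
    exists r; do 2!split=> //; case: hrU => // hrU.
    case: (h r hr (trans hr hq hp hrq hqp)) => _ /(_ hrU) hr0.
    by case: (cone_zero hB he hr).
  have hqU := hUd p q hpU hq hqp; split=> [_|/(hUU' _ hqU)] //.
  exact: (cone_one hB he hq).
Qed.

(* Enumerating [A] and [M] in order type [Ord] pairs each [b ∈ M] with some [a ∈ A];
   then take [X = {a | ¬ L a b}] and [U = X^⊥⊥], so that [U] and [A] meet in [X]. *)
Lemma diagonal_class A L : A ∈ C -> antichain P R A -> A ∉ M -> L ∈ C ->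
  exists U, U ∈ C /\ incl U P /\
  (forall p q, p ∈ U -> q ∈ P -> rel R q p -> q ∈ U) /\
  (forall p, p ∈ P -> dense_below (fun q => q ∈ U) p -> p ∈ U) /\
  forall b, b ∈ M -> exists p, p ∈ P /\ ~ (rel L p b <-> p ∈ U).
Proof.
move=> hA [hAP hAanti] hAM hL.
case: (enumeration hA hAM) => FA [hFA [hFAd [_ [hFAi [hFAt _]]]]].
case: model_enumeration => FM [hFM [hFMd [hFMf hFMs]]].
have : mdefinable1 (fun a => exists i, i ∈ O /\ rel FA i a /\
    exists b, b ∈ M /\ rel FM i b /\ ~ rel L a b) by def_tac.
case/comprehension => X [hX hXx].
have hXA : incl X A.
  by move=> a /hXx [_ [i [_ [/hFAd [_ ha] _]]]].
have : mdefinable1 (fun p => p ∈ P /\ forall q, q ∈ P -> rel R q p ->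
    exists r, r ∈ P /\ rel R r q /\ exists a, a ∈ X /\ rel R r a) by def_tac.
case/comprehension => U [hU hUx].
pose below r := exists a, a ∈ X /\ rel R r a.
have hUE p : p ∈ P -> (p ∈ U <-> dense_below below p).
  by move=> hp; rewrite hUx; split=> [[_ []] //|h]; split=> //; mem_tac.
have hUP : incl U P by move=> p /hUx [_ []].
exists U; split=> //; split=> //; split.
  move=> p q hpU hq hqp; have hp := hUP _ hpU; apply/hUE => // r hr hrq.
  by move/(hUE _ hp): hpU; apply=> //; apply: trans hrq hqp.
split.
  move=> p hp h; apply/hUE => //; apply: dense_below_bind h _ => // q hq _.
  by rewrite hUE.
move=> b hb; case: (hFMs b hb) => i hib; case: (hFMd _ _ hib) => hi _.
case: (hFAt i hi) => a hia; case: (hFAd _ _ hia) => _ ha; have haP := hAP _ ha.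
exists a; split=> //.
(* If [a ∈ A] lies in [U], it is compatible with some [x ∈ X]; both belong to the antichain [A], so
   they are equal. *)
have -> : a ∈ U <-> a ∈ X.
  rewrite hUE //; split=> [h|haX].
    case: (h a haP (refl haP)) => r [hr [hra [x [hx hrx]]]].
    suff -> : a = x by [].
    apply: NNPP => hne; apply: (hAanti a x ha (hXA _ hx) hne).
    by exists r.
  apply: dense_below_here => // r hr hra; by exists a.
have -> : a ∈ X <-> ~ rel L a b; last by tauto.
rewrite hXx; split=> [[_ [j [_ [hja [c [_ [hjc hn]]]]]]]|h].
  have e1 := hFAi _ _ _ hia hja; subst j.
  by rewrite (hFMf _ _ _ hib hjc).
by split; [mem_tac | exists i; do 2!split=> //; exists b].
Qed.

(** The diagonalization runs against the cone relation [L] of [B0]. Elements of [dom B0] are sets of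
    the model, so an enumeration of [M] meets them all and [U] is the cone of none of them. *)
Lemma Ord_cc_of_completion : has_unique_completion M C P R -> Ord_cc M C P R.
Proof.
move=> [B0 [e0 [hb0 huniq]]] A hA hanA; apply: NNPP => hAM.
case: (cone_class hb0) => L [hL hLx].
case: (diagonal_class hA hanA hAM hL) => U [hU [hUP [hUd [hUr hdiag]]]].
case: (completion_with_class hb0 hU hUP hUd hUr) => B1 [e1 [hb1 [c [hc hcU]]]].
case: (cones_of_isomorphic hb0 (huniq B1 e1 hb1) hc) => b [hb hbc].
case: (bc_classes hb0) => hdC _; have hbM : b ∈ M by mem_tac.
case: (hdiag b hbM) => p [hp]; apply.
by rewrite hLx // hbc // hcU.
Qed.

End Model.

Theorem theorem9p4 (V : set_structure) (hV : ZFC V)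
    (M C : V) (hM : ctm_GBminus M C) (hW : has_wellorder_of_type_Ord M C)
    (P R : V) (hP : class_forcing C P R)
    (hsep : separative P R) (hanti : antisymmetric P R) :
  has_unique_completion M C P R <-> Ord_cc M C P R.
Proof.
case: hW => W [hWC [_ [hwo [O [f [G [hO [hG [hf hfW]]]]]]]]].
split.
  exact: (Ord_cc_of_completion hV hM hWC hwo hO hG hf hfW hP hanti).
exact: (completion_of_Ord_cc hV hM hWC hwo hO hf hfW hP hanti hsep).
Qed.
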